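(* Let $(\mathcal{J}_1,\mathcal{J}_2)$ be an almost generalized Kähler structure on a real $2n$-dimensional manifold, with associated data $(g,b,J_\pm)$, and let $h=db$. Any one of the following conditions is equivalent to the integrability of the generalized Kähler structure (i.e. to $\mathcal{J}_1$ and $\mathcal{J}_2$ both being Courant integrable): (i) The bundles $L_1^+$ and $L_1^-$ are Courant integrable (their spaces of smooth sections are closed under the Courant bracket). (ii) $J_+$ and $J_-$ are integrable and $d^c_-\omega_-=-d^c_+\omega_+=h$. (iii) $\nabla^\pm J_\pm=0$ and $h$ is of type $(2,1)+(1,2)$ with respect to both $J_+$ and $J_-$ (the latter condition is implied by $J_\pm$ integrable).
   Context: $T\oplus T^*$ carries the inner product $\langle X+\xi,Y+\eta\rangle=\frac12(\xi(Y)+\eta(X))$ and the Courant bracket $[X+\xi,Y+\eta]=[X,Y]+\mathcal{L}_X\eta-\mathcal{L}_Y\xi-\frac12 d(i_X\eta-i_Y\xi)$. A generalized almost complex structure is an orthogonal endomorphism $\mathcal{J}$ of $T\oplus T^*$ with $\mathcal{J}^2=-1$; it is integrable if the sections of its $+i$-eigenbundle are closed under the Courant bracket. An almost generalized Kähler structure is a pair $(\mathcal{J}_1,\mathcal{J}_2)$ of commuting generalized almost complex structures such that $G=-\mathcal{J}_1\mathcal{J}_2$ is a positive definite metric on $T\oplus T^*$, i.e. $\langle Gx,x\rangle>0$ for $x\neq0$. It is a generalized Kähler structure (integrable) if $\mathcal{J}_1$ and $\mathcal{J}_2$ are both integrable. Let $C_\pm$ be the $\pm1$-eigenbundles of $G$.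 The projection $\pi:T\oplus T^*\to T$ restricts to isomorphisms $C_\pm\cong T$, and there are a unique Riemannian metric $g$ and 2-form $b$ such that $C_\pm$ is the graph of $b\pm g:T\to T^*$ (2-forms are viewed as maps $X\mapsto i_Xb$). The almost complex structures $J_\pm$ on $T$ are the transports of $\mathcal{J}_1|_{C_\pm}$ by $\pi|_{C_\pm}$; they are orthogonal for $g$. Put $\omega_\pm=gJ_\pm$, i.e. $\omega_\pm(X,Y)=g(J_\pm X,Y)$. When $J_\pm$ is integrable, $d^c_\pm=i(\bar\partial_\pm-\partial_\pm)$. $L_1$ is the $+i$-eigenbundle of $\mathcal{J}_1$, and $L_1^\pm=L_1\cap(C_\pm\otimes\mathbb{C})$. $\nabla$ is the Levi-Civita connection of $g$, and $\nabla^\pm=\nabla\pm\frac12 g^{-1}h$, i.e. $\nabla^\pm_XY=\nabla_XY\pm\frac12g^{-1}(h(X,Y,\cdot))$. ''$\nabla^\pm J_\pm=0$'' means $\nabla^+J_+=0$ and $\nabla^-J_-=0$.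
   Formalization: The remark in (iii) that the type condition is implied by J± integrable is stated under the further assumption ∇^±J_±=0, since without it the remark fails (flat C³ with b=Re(z₁dz₂∧dz₃)). *)

(* Defs.v *)
From HB Require Import structures.
From mathcomp Require Import all_boot all_order all_algebra.
From mathcomp Require Import all_classical all_reals all_analysis.
Import Order.TTheory GRing.Theory Num.Theory numFieldNormedType.Exports.

Set Implicit Arguments.
Unset Strict Implicit.
Unset Printing Implicit Defensive.

Local Open Scope classical_set_scope.
Local Open Scope ring_scope.

(** * Smooth functions on open subsets of R^m *)

Section SmoothOn.
Variables (R : realType) (m : nat).
Implicit Types (U : set 'rV[R]_m) (f g : 'rV[R]_m -> R) (k : nat).

(* All iterated partial derivatives of order <= k exist and are continuous
   on U. Only used for U open. *)
Fixpoint Ck k U f : Prop :=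
  (forall x, U x -> {for x, continuous f}) /\
  match k with
  | 0 => True
  | k'.+1 => forall i : 'I_m,
      (forall x, U x -> derivable f x (delta_mx 0 i)) /\
      Ck k' U (fun x => 'D_(delta_mx 0 i) f x)
  end.

Definition smooth_on U f := forall k, Ck k U f.

Lemma Ck_ext k U f g : open U -> (forall x, U x -> f x = g x) ->
  Ck k U f -> Ck k U g.
Proof.
move=> oU; elim: k f g => [|k IH] f g fg /= [cf df].
all: have nfg x : U x -> {near x, f =1 g}
  by move=> Ux; apply: filterS (open_nbhs_nbhs (conj oU Ux)).
all: have cg x (Ux : U x) : {for x, continuous g}
  by rewrite /prop_for /continuous_at -(fg _ Ux);
     apply: cvg_trans (cf x Ux); apply: (@near_eq_cvg _ _ (nbhs x)); exact: nfg.
  by split.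
split=> // i; have [df1 df2] := df i; split=> [x Ux|].
  exact: near_eq_derivable (nfg x Ux) (df1 x Ux).
by apply: IH df2 => x Ux; apply: near_eq_derive; exact: nfg.
Qed.

Lemma CkW k U f : Ck k.+1 U f -> Ck k U f.
Proof.
elim: k f => [|k IH] f [cf df]; first by split.
by split=> // i; have [d1 d2] := df i; split=> //; exact: IH.
Qed.

Lemma Ck_cst k U (a : R) : open U -> Ck k U (cst a).
Proof.
move=> oU; elim: k a => [|k IH] a /=; split=> //; try by move=> x _; exact: cst_continuous.
move=> i; split=> [x _|]; first exact: derivable_cst.
by apply: (@Ck_ext _ _ (cst 0)) (IH 0) => // x _; rewrite derive_cst.
Qed.

Lemma CkD k U f g : open U -> Ck k U f -> Ck k U g -> Ck k U (f + g).
Proof.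
move=> oU; elim: k f g => [|k IH] f g [cf df] [cg dg] /=; split=> //.
1,2: by move=> x Ux; apply: continuousD; [exact: cf | exact: cg].
move=> i; have [df1 df2] := df i; have [dg1 dg2] := dg i; split=> [x Ux|].
  by apply: derivableD; [exact: df1 | exact: dg1].
apply: Ck_ext (IH _ _ df2 dg2) => // x Ux.
by rewrite deriveD//; [exact: df1 | exact: dg1].
Qed.

Lemma CkM k U f g : open U -> Ck k U f -> Ck k U g -> Ck k U (f * g).
Proof.
move=> oU; elim: k f g => [|k IH] f g Cf Cg.
all: have [cf df] := Cf; have [cg dg] := Cg; split=> //.
1,2: by move=> x Ux; apply: continuousM; [exact: cf | exact: cg].
move=> i; have [df1 df2] := df i; have [dg1 dg2] := dg i; split=> [x Ux|].
  by apply: derivableM; [exact: df1 | exact: dg1].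
apply: (Ck_ext oU _ (CkD oU (IH _ _ (CkW Cf) dg2) (IH _ _ (CkW Cg) df2))) => x Ux.
by rewrite deriveM//; [exact: df1 | exact: dg1].
Qed.

End SmoothOn.

(** * Smooth manifolds *)

(* The local inverse is a total function; only its values on the image of
   the chart domain matter. *)
Record chart (R : realType) (M : topologicalType) (m : nat) := Chart {
  chart_dom : set M;
  chart_map : M -> 'rV[R]_m;
  chart_inv : 'rV[R]_m -> M;
  chart_dom_open : open chart_dom;
  chart_img_open : open (chart_map @` chart_dom);
  chart_mapK : {in chart_dom, cancel chart_map chart_inv};
  chart_map_cts : forall p, chart_dom p -> {for p, continuous chart_map};
  chart_inv_cts : forall x, (chart_map @` chart_dom) x ->
    {for x, continuous chart_inv}
}.

Record manifold (R : realType) (m : nat) := Manifold {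
  mcarrier :> topologicalType;
  m_hausdorff : hausdorff_space mcarrier;
  m_second_countable : @second_countable mcarrier;
  atlas : set (chart R mcarrier m);
  atlas_cover : forall p, exists2 c, atlas c & chart_dom c p;
  atlas_compat : forall c c', atlas c -> atlas c' -> forall j,
    smooth_on (chart_map c @` (chart_dom c `&` chart_dom c'))
      (fun x => chart_map c' (chart_inv c x) 0 j)
}.

(** * Functions, vector fields and 1-forms *)

Section Calculus.
Variables (R : realType) (m : nat) (M : manifold R m).

Definition smooth (f : M -> R) : Prop := forall c, @atlas R m M c ->
  smooth_on (chart_map c @` chart_dom c) (f \o chart_inv c).

Definition smooth_pred : {pred M -> R} := fun f => `[< smooth f >].

Lemma smooth_subring_closed : subring_closed smooth_pred.
Proof.
have smcst a : smooth (cst a) by move=> c _ k; apply: Ck_cst; exact: chart_img_open.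
have smM f g : smooth f -> smooth g -> smooth (f * g).
  move=> sf sg c Ac k.
  exact: CkM (@chart_img_open _ _ _ c) (sf c Ac k) (sg c Ac k).
have smD f g : smooth f -> smooth g -> smooth (f + g).
  move=> sf sg c Ac k.
  exact: CkD (@chart_img_open _ _ _ c) (sf c Ac k) (sg c Ac k).
split=> [|f g /asboolP sf /asboolP sg|f g /asboolP sf /asboolP sg]; apply/asboolP.
- exact: smcst.
- apply: smD => //.
  have -> : - g = cst (-1) * g.
    by apply/funext => x; rewrite [RHS]mulN1r.
  exact: smM.
- exact: smM.
Qed.

HB.instance Definition _ :=
  GRing.isSubringClosed.Build (M -> R) smooth_pred smooth_subring_closed.

Record Cinf := MkCinf { Cinf_fun :> M -> R; _ : Cinf_fun \in smooth_pred }.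
HB.instance Definition _ := [isSub for Cinf_fun].
HB.instance Definition _ := [Choice of Cinf by <:].
HB.instance Definition _ := 
  GRing.SubChoice_isSubComPzRing.Build _ _ Cinf smooth_subring_closed.

Lemma smooth_cst_subproof (a : R) : cst a \in smooth_pred.
Proof. by apply/asboolP => c _ k; apply: Ck_cst; exact: chart_img_open. Qed.
Definition cstF (a : R) : Cinf := MkCinf (smooth_cst_subproof a).
Definition halfF : Cinf := cstF (2^-1).

(* Vector fields are R-linear derivations of C^oo(M), and tensor fields are
   C^oo(M)-multilinear maps on them; on a Hausdorff second countable manifold
   these are exactly the smooth sections of T and of the tensor bundles. *)
Definition derivation (X : Cinf -> Cinf^o) : Prop :=
  [/\ forall f g, X (f + g) = X f + X g,
      forall a f, X (cstF a * f) = cstF a * X f &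
      forall f g, X (f * g) = f * X g + X f * g].

Definition derivation_pred : {pred Cinf -> Cinf^o} :=
  fun X => `[< derivation X >].

Lemma derivation_submod_closed : submod_closed derivation_pred.
Proof.
split=> [|h X Y /asboolP[X1 X2 X3] /asboolP[Y1 Y2 Y3]]; apply/asboolP.
  by split=> *; rewrite [LHS]/GRing.zero/= /GRing.zero/= ?(addr0, mulr0, mul0r).
split=> [f g|a f|f g]; rewrite ![(h *: X + Y) _]/(h * X _ + Y _).
- by rewrite X1 Y1 mulrDr addrACA.
- by rewrite X2 Y2 mulrDr mulrCA.
- by rewrite X3 Y3 !(mulrDr, mulrDl) addrACA mulrCA !mulrA.
Qed.

HB.instance Definition _ := GRing.isSubmodClosed.Build Cinf (Cinf -> Cinf^o)
  derivation_pred derivation_submod_closed.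

Record VF := MkVF { VF_fun :> Cinf -> Cinf^o; VF_funP : VF_fun \in derivation_pred }.
HB.instance Definition _ := [isSub for VF_fun].
HB.instance Definition _ := [Choice of VF by <:].
HB.instance Definition _ := [SubChoice_isSubLmodule of VF by <:].

Definition tensorial (xi : VF -> Cinf^o) : Prop := linear xi.

Definition tensorial_pred : {pred VF -> Cinf^o} := fun xi => `[< tensorial xi >].

Lemma tensorial_submod_closed : submod_closed tensorial_pred.
Proof.
split=> [|h xi et /asboolP Hxi /asboolP Het]; apply/asboolP => f X Y.
  by rewrite [LHS]/GRing.zero/= /GRing.zero/= addr0 scaler0.
rewrite ![(h *: xi + et) _]/(h *: xi _ + et _) Hxi Het.
by rewrite !scalerDr addrACA !scalerA (mulrC h).
Qed.

HB.instance Definition _ := GRing.isSubmodClosed.Build Cinf (VF -> Cinf^o)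
  tensorial_pred tensorial_submod_closed.

Record Form1 := MkForm1 {
  Form1_fun :> VF -> Cinf^o; Form1_funP : Form1_fun \in tensorial_pred }.
HB.instance Definition _ := [isSub for Form1_fun].
HB.instance Definition _ := [Choice of Form1 by <:].
HB.instance Definition _ := [SubChoice_isSubLmodule of Form1 by <:].

Lemma VFP (X : VF) : derivation X.
Proof. exact/asboolP/VF_funP. Qed.

Lemma Form1P (xi : Form1) : linear xi.
Proof. exact/asboolP/Form1_funP. Qed.

Lemma VF_addE (X Y : VF) f : (X + Y) f = X f + Y f. Proof. by []. Qed.
Lemma VF_scaleE h (X : VF) f : (h *: X) f = h * X f. Proof. by []. Qed.
Lemma VF_ext (X Y : VF) : (forall f, X f = Y f) -> X = Y.
Proof. by move=> XY; apply/val_inj/funext. Qed.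

Lemma lie_subproof (X Y : VF) :
  ((fun f => X (Y f) - Y (X f)) : Cinf -> Cinf^o) \in derivation_pred.
Proof.
apply/asboolP; have [X1 X2 X3] := VFP X; have [Y1 Y2 Y3] := VFP Y.
split=> [f g|a f|f g].
- by rewrite X1 Y1 X1 Y1 opprD addrACA.
- by rewrite X2 Y2 X2 Y2 mulrBr.
- rewrite Y3 X1 !X3 Y1 !Y3 mulrBr mulrBl.
  set a := f * X _; set b := X f * Y g; set c := Y f * X g; set d := X (Y f) * g.
  set a' := f * Y _; set d' := Y _ * g.
  rewrite [X in _ - X](_ : _ = (b + c) + (a' + d')); last first.
    by rewrite [a' + c]addrC addrACA [c + b]addrC.
  rewrite [X in X - _](_ : _ = (b + c) + (a + d)); last first.
    by rewrite [a + b]addrC addrACA.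
  by rewrite opprD addrACA subrr add0r opprD addrACA.
Qed.
Definition lie (X Y : VF) : VF := MkVF (lie_subproof X Y).

Lemma lieE (X Y : VF) f : lie X Y f = X (Y f) - Y (X f). Proof. by []. Qed.

Lemma d0_subproof (f : Cinf) : ((fun X : VF => X f) : VF -> Cinf^o) \in tensorial_pred.
Proof. by apply/asboolP. Qed.
Definition d0 (f : Cinf) : Form1 := MkForm1 (d0_subproof f).

Lemma lieD1_subproof (X : VF) (xi : Form1) :
  ((fun Y : VF => X (xi Y) - xi (lie X Y)) : VF -> Cinf^o) \in tensorial_pred.
Proof.
apply/asboolP => h Y Z; have [X1 X2 X3] := VFP X; have xiL := Form1P xi.
have -> : lie X (h *: Y + Z) = h *: lie X Y + (X h *: Y + lie X Z).
  apply: VF_ext => f; rewrite lieE !VF_addE !VF_scaleE !lieE X1 X3.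
  rewrite mulrBr -!addrA; congr (_ + _); rewrite opprD !addrA; congr (_ - _).
  by rewrite addrC -!addrA.
rewrite !xiL X1 X3 opprD; set a := h * X _; set b := X h * _.
rewrite -[h *: (_ - _)]/(h * (_ - _)) mulrBr -/a.
rewrite -[h *: xi (lie X Y)]/(h * xi (lie X Y)) -[X h *: xi Y]/b.
rewrite opprD -!addrA; congr (_ + _).
by rewrite addrCA [RHS]addrCA [b + _]addrCA addNKr.
Qed.

(* Lie derivative of a 1-form: (L_X xi)(Y) = X(xi(Y)) - xi([X, Y]). *)
Definition lieD1 (X : VF) (xi : Form1) : Form1 := MkForm1 (lieD1_subproof X xi).

End Calculus.

Notation TT M := (VF M * Form1 M)%type.

(** * Complexification

   Elements of the complexification of V are pairs (u, v), standing for
   u + i v. So cplx (VF M), cplx (TT M) and cplx (Cinf M) are the smooth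
   sections of T (x) C and (T (+) T^* ) (x) C and the smooth complex functions. *)

Notation cplx V := (V * V)%type.

Definition imul (V : zmodType) (x : cplx V) : cplx V := (- x.2, x.1).

Definition csub (V : zmodType) (S : set V) : set (cplx V) := [set x | S x.1 /\ S x.2].

(* Complex (multi)linear extensions of real (multi)linear maps. *)
Definition cmap (V W : zmodType) (f : V -> W) (x : cplx V) : cplx W :=
  (f x.1, f x.2).

Definition cbil (V W U : zmodType) (B : V -> W -> U) (x : cplx V) (y : cplx W) :
    cplx U :=
  cmap (B x.1) y + imul (cmap (B x.2) y).

Definition ctri (V U : zmodType) (T : V -> V -> V -> U) (x y z : cplx V) : cplx U :=
  cbil (T x.1) y z + imul (cbil (T x.2) y z).

(* Sections of the +i-eigenbundle of (the complexification of) J. *)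
Definition eigen_i (V : zmodType) (J : V -> V) : set (cplx V) :=
  [set x | cmap J x = imul x].

Definition closed_under (V : Type) (br : V -> V -> V) (L : set V) : Prop :=
  forall x y, L x -> L y -> L (br x y).

(* Exterior derivative of a 2-form, for vector fields V acting on functions F
   by act and with Lie bracket br; used over the reals and over C. *)
Definition ext_d2 (V F : zmodType) (act : V -> F -> F) (br : V -> V -> V)
    (a : V -> V -> F) (X Y Z : V) : F :=
  act X (a Y Z) - act Y (a X Z) + act Z (a X Y)
  - a (br X Y) Z + a (br X Z) Y - a (br Y Z) X.

Section GeneralizedGeometry.
Variables (R : realType) (m : nat) (M : manifold R m).

Local Notation F := (Cinf M).

(** ** The Courant algebroid T (+) T^* *)

Definition pairing (x y : TT M) : F := halfF M * (x.2 y.1 + y.2 x.1).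

Definition courant (x y : TT M) : TT M :=
  (lie x.1 y.1,
   lieD1 x.1 y.2 - lieD1 y.1 x.2 - halfF M *: d0 (y.2 x.1 - x.2 y.1 : F)).

(* Bundle endomorphisms are C^oo(M)-linear maps on sections. *)
Definition gen_almost_complex (J : {linear TT M -> TT M}) : Prop :=
  (forall x y, pairing (J x) (J y) = pairing x y) /\ (forall x, J (J x) = - x).

Definition courant_integrable (L : set (cplx (TT M))) : Prop :=
  closed_under (cbil courant) L.

(* Values of sections at a point; at a point p, X is identified with the
   derivation f |-> (X f)(p). *)
Definition VF_nonzero_at (X : VF M) (p : M) : Prop := exists f, X f p != 0.
Definition Form1_nonzero_at (xi : Form1 M) (p : M) : Prop :=
  exists X, (xi X : F) p != 0.
Definition TT_nonzero_at (x : TT M) (p : M) : Prop :=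
  VF_nonzero_at x.1 p \/ Form1_nonzero_at x.2 p.

Definition gen_metric (J1 J2 : {linear TT M -> TT M}) (x : TT M) : TT M :=
  - J1 (J2 x).

Definition almost_gen_kahler (J1 J2 : {linear TT M -> TT M}) : Prop :=
  [/\ gen_almost_complex J1,
      gen_almost_complex J2,
      forall x, J1 (J2 x) = J2 (J1 x) &
      forall x p, TT_nonzero_at x p -> 0 < pairing (gen_metric J1 J2 x) x p].

Definition Cplus (J1 J2 : {linear TT M -> TT M}) : set (TT M) :=
  [set x | gen_metric J1 J2 x = x].
Definition Cminus (J1 J2 : {linear TT M -> TT M}) : set (TT M) :=
  [set x | gen_metric J1 J2 x = - x].

Definition L1plus (J1 J2 : {linear TT M -> TT M}) : set (cplx (TT M)) :=
  eigen_i J1 `&` csub (Cplus J1 J2).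
Definition L1minus (J1 J2 : {linear TT M -> TT M}) : set (cplx (TT M)) :=
  eigen_i J1 `&` csub (Cminus J1 J2).

Definition gen_kahler_integrable (J1 J2 : {linear TT M -> TT M}) : Prop :=
  courant_integrable (eigen_i J1) /\ courant_integrable (eigen_i J2).

(** ** Metrics, 2-forms, and the data (g, b, J+, J-)

   Bilinear forms and 2-forms are given as C^oo(M)-linear maps T -> T^*,
   X |-> i_X b. *)

Definition riemannian (g : {linear VF M -> Form1 M}) : Prop :=
  (forall X Y, g X Y = g Y X) /\
  (forall X p, VF_nonzero_at X p -> 0 < (g X X : F) p).

Definition is_2form (b : {linear VF M -> Form1 M}) : Prop :=
  forall X, b X X = 0.

Record associated_data (J1 J2 : {linear TT M -> TT M})
    (g b : {linear VF M -> Form1 M}) (Jp Jm : {linear VF M -> VF M}) : Prop := {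
  ad_metric : riemannian g;
  ad_2form : is_2form b;
  ad_Cplus : forall x, Cplus J1 J2 x <-> x.2 = b x.1 + g x.1;
  ad_Cminus : forall x, Cminus J1 J2 x <-> x.2 = b x.1 - g x.1;
  (* J+ and J- are the transports of J1 by the projection to T. *)
  ad_Jp : forall x, Cplus J1 J2 x -> Jp x.1 = (J1 x).1;
  ad_Jm : forall x, Cminus J1 J2 x -> Jm x.1 = (J1 x).1
}.

(** ** Complex structures and types of forms *)

(* Involutivity of T^{1,0}, i.e. the vanishing of the Nijenhuis tensor. *)
Definition cx_integrable (J : {linear VF M -> VF M}) : Prop :=
  closed_under (cbil (@lie R m M)) (eigen_i J).

Definition d2 (a : VF M -> VF M -> F) : VF M -> VF M -> VF M -> F :=
  ext_d2 (fun (X : VF M) (f : F) => X f) (@lie R m M) a.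

Definition cd2 (a : cplx (VF M) -> cplx (VF M) -> cplx F) :
    cplx (VF M) -> cplx (VF M) -> cplx (VF M) -> cplx F :=
  ext_d2 (cbil (fun (X : VF M) (f : F) => X f)) (cbil (@lie R m M)) a.

(* Projections onto T^{1,0} (s = true) and T^{0,1} (s = false). *)
Definition proj_type (J : {linear VF M -> VF M}) (s : bool)
    (X : cplx (VF M)) : cplx (VF M) :=
  halfF M *: (if s then X - imul (cmap J X) else X + imul (cmap J X)).

(* Components of type (p, 2 - p), resp. (p, 3 - p), of a complex form. *)
Definition comp2 (J : {linear VF M -> VF M}) (p : nat)
    (a : cplx (VF M) -> cplx (VF M) -> cplx F) (X Y : cplx (VF M)) : cplx F :=
  \sum_(s : bool) \sum_(t : bool | (s + t == p)%N)
    a (proj_type J s X) (proj_type J t Y).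

Definition comp3 (J : {linear VF M -> VF M}) (p : nat)
    (a : cplx (VF M) -> cplx (VF M) -> cplx (VF M) -> cplx F)
    (X Y Z : cplx (VF M)) : cplx F :=
  \sum_(s : bool) \sum_(t : bool) \sum_(u : bool | (s + t + u == p)%N)
    a (proj_type J s X) (proj_type J t Y) (proj_type J u Z).

(* On forms of type (p, q), del and delbar are the components of d of type
   (p + 1, q) and (p, q + 1); here p + q = 2. *)
Definition del (J : {linear VF M -> VF M})
    (a : cplx (VF M) -> cplx (VF M) -> cplx F) (X Y Z : cplx (VF M)) : cplx F :=
  \sum_(p < 3) comp3 J p.+1 (cd2 (comp2 J p a)) X Y Z.

Definition delbar (J : {linear VF M -> VF M})
    (a : cplx (VF M) -> cplx (VF M) -> cplx F) (X Y Z : cplx (VF M)) : cplx F :=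
  \sum_(p < 3) comp3 J p (cd2 (comp2 J p a)) X Y Z.

Definition dc (J : {linear VF M -> VF M})
    (a : cplx (VF M) -> cplx (VF M) -> cplx F) (X Y Z : cplx (VF M)) : cplx F :=
  imul (delbar J a X Y Z - del J a X Y Z).

Definition omega (g : {linear VF M -> Form1 M}) (J : {linear VF M -> VF M})
    (X Y : VF M) : F := g (J X) Y.

Definition type_21_12 (J : {linear VF M -> VF M})
    (h : VF M -> VF M -> VF M -> F) : Prop :=
  forall X Y Z, ctri h X Y Z = comp3 J 2 (ctri h) X Y Z + comp3 J 1 (ctri h) X Y Z.

(** ** Connections *)

Record levi_civita (g : {linear VF M -> Form1 M})
    (nabla : VF M -> VF M -> VF M) : Prop := {
  lc_linl : forall (f : F) (X X' Y : VF M),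
     nabla (f *: X + X') Y = f *: nabla X Y + nabla X' Y;
  lc_addr : forall X Y Y' : VF M, nabla X (Y + Y') = nabla X Y + nabla X Y';
  lc_leibniz : forall (f : F) (X Y : VF M),
     nabla X (f *: Y) = (X f : F) *: Y + f *: nabla X Y;
  lc_torsion : forall X Y : VF M, nabla X Y - nabla Y X = lie X Y;
  lc_metric : forall X Y Z : VF M,
     X (g Y Z) = g (nabla X Y) Z + g Y (nabla X Z)
}.

(* g^{-1} xi: the vector field Z with g(Z, -) = xi. *)
Definition sharp (g : {linear VF M -> Form1 M}) (xi : VF M -> F) : VF M :=
  xget 0 [set Z | forall W, g Z W = xi W].

Definition nabla_plus (g : {linear VF M -> Form1 M}) (nabla : VF M -> VF M -> VF M)
    (h : VF M -> VF M -> VF M -> F) (X Y : VF M) : VF M :=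
  nabla X Y + halfF M *: sharp g (h X Y).

Definition nabla_minus (g : {linear VF M -> Form1 M}) (nabla : VF M -> VF M -> VF M)
    (h : VF M -> VF M -> VF M -> F) (X Y : VF M) : VF M :=
  nabla X Y - halfF M *: sharp g (h X Y).

Definition parallel (D : VF M -> VF M -> VF M) (J : {linear VF M -> VF M}) : Prop :=
  forall X Y, D X (J Y) = J (D X Y).

End GeneralizedGeometry.

(* Main.v *)
(* The +i-eigenbundle of J consists of the u - i J u, so it is closed under a
   bracket iff N_J(u, v) = [u, v] - [Ju, Jv] + J([u, Jv] + [Ju, v]) vanishes. For
   an orthogonal J, the form <N_J(u, v), w> of the Courant bracket is totally skew;
   since J1 and J2 agree up to sign on C+ and on C-, N_J1 = N_J2 = 0 reduces to
   the pairs in C+ and the pairs in C-, i.e. to the closedness of L1+ and L1-.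

   C+ is the graph of b + g and C- that of b + (-g), so one computation, for a
   symmetric nondegenerate g of any signature, handles both signs. Closedness of
   L1+ splits into the vector part N_J = 0 and the form part
     2 g((nabla_X J) Y, Z) = - (h(X, JY, Z) + h(X, Y, JZ)),
   which is exactly nabla^+ J = 0. Given the form part, g(N_J(X, Y), Z) is the
   (3,0)+(0,3) part of h, hence (iii). Given N_J = 0, d omega determines nabla J
   through 2 g((nabla_X J) Y, Z) = d omega(X, Y, Z) - d omega(X, JY, JZ), and the
   form part becomes - d^c omega = h, hence (ii). *)
Require Import Defs.
From HB Require Import structures.
From mathcomp Require Import all_boot all_order all_algebra.
From mathcomp Require Import all_classical all_reals all_analysis.
From mathcomp Require Import ring.
Import Order.TTheory GRing.Theory Num.Theory numFieldNormedType.Exports.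

Local Open Scope classical_set_scope.
Local Open Scope ring_scope.

(* These let [ring] prove a goal from hypotheses, given as a linear combination. *)
Lemma eq_lincomb {F : comPzRingType} {a b x y : F} : a = b -> x - y = a - b -> x = y.
Proof. by move=> -> /eqP; rewrite subrr subr_eq0 => /eqP. Qed.

Lemma eq_lincomb2 {F : comPzRingType} {a b a' b' x y : F} :
  a = b -> a' = b' -> x - y = a - b + (a' - b') -> x = y.
Proof. by move=> -> ->; rewrite !subrr addr0 => /eqP; rewrite subr_eq0 => /eqP. Qed.

Lemma eq_lincomb3 {F : comPzRingType} {a b a' b' a2 b2 x y : F} :
  a = b -> a' = b' -> a2 = b2 -> x - y = a - b + (a' - b') + (a2 - b2) -> x = y.
Proof. by move=> -> -> ->; rewrite !subrr !addr0 => /eqP; rewrite subr_eq0 => /eqP. Qed.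

Lemma additive_opp {U W : zmodType} (f : U -> W) :
  (forall x y, f (x + y) = f x + f y) -> forall x, f (- x) = - f x.
Proof.
move=> fD x; have f0 : f 0 = 0 by apply: (@addrI _ (f 0)); rewrite -fD !addr0.
by apply: (@addrI _ (f x)); rewrite -fD !subrr f0.
Qed.

(** * Brackets and the +i-eigenbundle *)

Definition nijenhuis {V : zmodType} (br : V -> V -> V) (J : V -> V) (u v : V) : V :=
  br u v - br (J u) (J v) + J (br u (J v) + br (J u) v).

Section ClosedEigen.
Variables (V : zmodType) (br : V -> V -> V) (J : {additive V -> V}).
Hypothesis brDl : forall u u' v, br (u + u') v = br u v + br u' v.
Hypothesis brDr : forall u v v', br u (v + v') = br u v + br u v'.
Hypothesis JJ : forall u, J (J u) = - u.

(** Eigenvectors over [C] are the pairs (u, -Ju) with u in [C]. The bracket of two of them is (a,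
    -b) with a = [u, v] - [Ju, Jv] and b = [u, Jv] + [Ju, v]. It is an eigenvector iff a + Jb = 0,
    and then b = Ja lies in [C] as soon as a does. *)
Lemma closed_eigen (C : set V) :
  (forall u, C u -> C (J u)) -> (forall u, C u -> C (- u)) ->
  closed_under (cbil br) (eigen_i J `&` csub C) <->
  forall u v, C u -> C v ->
    nijenhuis br J u v = 0 /\ C (br u v - br (J u) (J v)).
Proof.
move=> CJ CN.
have brNl u v : br (- u) v = - br u v.
  exact: (additive_opp (fun x => br x v) (fun x y => brDl x y v)).
have brNr u v : br u (- v) = - br u v by exact: (additive_opp (br u) (brDr u)).
have br_eigen u v : cbil br (u, - J u) (v, - J v) =
    (br u v - br (J u) (J v), - (br u (J v) + br (J u) v)).
  rewrite /cbil /imul /cmap /= !brNl !brNr opprK.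
  by congr (_, _); rewrite /= opprD.
split=> [cl u v Cu Cv|N0].
  have eigE w : C w -> (eigen_i J `&` csub C) (w, - J w).
    move=> Cw; split; last by split=> //=; apply/CN/CJ.
    by rewrite /eigen_i/= /cmap /imul /= raddfN /= JJ !opprK.
  have [] := cl _ _ (eigE u Cu) (eigE v Cv).
  rewrite br_eigen /eigen_i/= /cmap /imul /= opprK raddfN /=.
  by move=> [_ E] [Cw _]; rewrite /nijenhuis -[X in X + _]E addNr.
move=> [u x2] [v y2]; rewrite /eigen_i/= => -[] [E1 _] [Cu _] [] [E2 _] [Cv _].
rewrite /imul /= in E1 E2 Cu Cv.
rewrite -[x2]opprK -[y2]opprK -E1 -E2 br_eigen.
have [/eqP + Cw] := N0 _ _ Cu Cv; rewrite addr_eq0 => /eqP E.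
have E' : J (br u v - br (J u) (J v)) = br u (J v) + br (J u) v.
  by rewrite E raddfN JJ opprK.
split; first by rewrite /= /cmap /imul /= opprK E' raddfN -E.
by split=> //=; rewrite -E'; apply/CN/CJ.
Qed.

Lemma closed_eigenT :
  closed_under (cbil br) (eigen_i J) <-> forall u v, nijenhuis br J u v = 0.
Proof.
have -> : eigen_i J = eigen_i J `&` csub setT.
  by apply/seteqP; split=> [x Lx|x []] //; split.
rewrite closed_eigen //.
by split=> [H u v|H u v _ _]; [have [] := H u v I I | split].
Qed.

Lemma nijenhuisDl u u' v :
  nijenhuis br J (u + u') v = nijenhuis br J u v + nijenhuis br J u' v.
Proof.
have JD x y : J (x + y) = J x + J y by exact: raddfD.
rewrite /nijenhuis !JD !brDl !JD.
by rewrite opprD [X in X + _ = _]addrACA [X in _ + X = _]addrACA [LHS]addrACA.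
Qed.

End ClosedEigen.
Arguments closed_eigen {V br} J brDl brDr JJ {C}.
Arguments closed_eigenT {V br} J.
Arguments nijenhuisDl {V br} J.

(** * Hermitian tensor calculus *)

(* [D] is the Levi-Civita connection, [act] the action on functions, [A X] stands
   for [D_X J], [w] for [d omega], and [h] for an arbitrary 3-form. *)
Section Hermitian.
Variables (F : comPzRingType) (half : F) (V : zmodType).
Hypothesis halfK : half + half = 1.
Variables (act : V -> F -> F) (D : V -> V -> V) (g : V -> V -> F).
Variable J : {additive V -> V}.
Hypothesis actD : forall X f f', act X (f + f') = act X f + act X f'.
Hypothesis DDl : forall X X' Y, D (X + X') Y = D X Y + D X' Y.
Hypothesis DDr : forall X Y Y', D X (Y + Y') = D X Y + D X Y'.
Hypothesis gDl : forall X X' Y, g (X + X') Y = g X Y + g X' Y.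
Hypothesis gC : forall X Y, g X Y = g Y X.
Hypothesis g_inj : forall X, (forall Y, g X Y = 0) -> X = 0.
Hypothesis Dg : forall X Y Z, act X (g Y Z) = g (D X Y) Z + g Y (D X Z).
Hypothesis JJ : forall X, J (J X) = - X.
Hypothesis gJ : forall X Y, g (J X) (J Y) = g X Y.

Variables (lie A : V -> V -> V).
Hypothesis lieE : forall X Y, lie X Y = D X Y - D Y X.
Hypothesis AE : forall X Y, A X Y = D X (J Y) - J (D X Y).

Let double_inj (x y : F) : x + x = y + y -> x = y.
Proof.
move=> E; rewrite -[x]mul1r -[y]mul1r -halfK.
by rewrite !mulrDl -!mulrDr E.
Qed.

Let gNl X Y : g (- X) Y = - g X Y.
Proof. exact: (additive_opp (g^~ Y) (fun x y => gDl x y Y)). Qed.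
Let gDr X Y Y' : g X (Y + Y') = g X Y + g X Y'.
Proof. by rewrite !(gC X) gDl. Qed.
Let gNr X Y : g X (- Y) = - g X Y.
Proof. by rewrite !(gC X) gNl. Qed.
Let actN X f : act X (- f) = - act X f.
Proof. exact: (additive_opp (act X) (actD X)). Qed.
Let DNl X Y : D (- X) Y = - D X Y.
Proof. exact: (additive_opp (D^~ Y) (fun x y => DDl x y Y)). Qed.
Let DNr X Y : D X (- Y) = - D X Y.
Proof. exact: (additive_opp (D X) (DDr X)). Qed.
Let gJr X Y : g X (J Y) = - g (J X) Y.
Proof. by rewrite -gJ JJ gNr; ring. Qed.

Let gE := (gDl, gDr, gNl, gNr).

Let JN X : J (- X) = - J X. Proof. exact: raddfN. Qed.
Let JD X Y : J (X + Y) = J X + J Y. Proof. exact: raddfD. Qed.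

(** This is the derivative of J^2 = -1. *)
Let DJ_J X Y : A X (J Y) = - J (A X Y).
Proof. by rewrite !AE raddfB /= !JJ DNr opprB addrC. Qed.

Let DJNl X Y : A (- X) Y = - A X Y.
Proof. by rewrite !AE !DNl raddfN opprB opprK addrC. Qed.

Let gJ_skew X Y : g (J X) Y = - g (J Y) X.
Proof. by rewrite gC gJr. Qed.

Let DJE X Y : D X (J Y) = A X Y + J (D X Y).
Proof. by rewrite !AE subrK. Qed.

Let gDJ X Y Z : g (A X Y) Z = - g (A X Z) Y.
Proof.
(* Both equations differentiate the same function up to sign, since g(JY, Z) = - g(Y, JZ). *)
have E1 := Dg X (J Y) Z; have E2 := Dg X Y (J Z).
rewrite (gC (J Y) (D X Z)) in E1.
rewrite gJr actN (gC Y (D X (J Z))) in E2.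
by apply: (eq_lincomb2 (esym E1) (esym E2)); rewrite !AE !gE !gJr; ring.
Qed.

Let gDJJ X Y Z : g (A X Y) (J Z) = - g (A X Z) (J Y).
Proof. by rewrite gDJ DJ_J gNl opprK gJ_skew gC gJr gC. Qed.

Let DJNr X Y : A X (- Y) = - A X Y.
Proof. by rewrite !AE JN !DNr JN opprK opprB addrC. Qed.

(** The left side is what g contributes to the Courant bracket of two sections of the graph
    ([courant_graph]). Metricity and vanishing torsion cancel all derivatives except those along
    Z. *)
Lemma lie_torsion_free X Y Z :
  act X (g Y Z) - g Y (lie X Z) - (act Y (g X Z) - g X (lie Y Z))
  - g (lie X Y) Z = g (D Z X) Y - g (D Z Y) X.
Proof.
rewrite !lieE !gE !Dg (gC Y (D Z X)) (gC X (D Z Y)) (gC X (D Y Z)) (gC Y (D X Z)).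
by ring.
Qed.

(** The right side of [lie_torsion_free] is not tensorial in X and Y, but its difference from the
    value at JX, JY is: as J is orthogonal, g(J D_Z X, JY) cancels g(D_Z X, Y), and the two
    remaining terms in [A] agree by skewness. *)
Lemma lie_twist X Y Z :
  g (D Z X) Y - g (D Z Y) X - (g (D Z (J X)) (J Y) - g (D Z (J Y)) (J X)) =
  g (A Z Y) (J X) *+ 2.
Proof. by rewrite !DJE !gE !gJ gDJJ; ring. Qed.

(** Vanishing torsion turns brackets into covariant derivatives; those that do not fall on J
    cancel. *)
Lemma nijenhuis_DJ X Y Z : g (nijenhuis lie J X Y) Z =
  g (A Y X) (J Z) - g (A X Y) (J Z) - g (A (J X) Y) Z + g (A (J Y) X) Z.
Proof.
by rewrite /nijenhuis !lieE !DJE !(JD, JN) !JJ !gE !gJr; ring.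
Qed.

Variable w : V -> V -> V -> F.
Hypothesis wE : forall X Y Z, w X Y Z = ext_d2 act lie (fun X Y => g (J X) Y) X Y Z.

(** Since D is metric, g(A X Y, Z) is (D_X omega)(Y, Z); for a torsion-free connection, d is the
    cyclic sum of the covariant derivative. *)
Lemma d_omegaE X Y Z : w X Y Z =
  g (A X Y) Z + g (A Y Z) X + g (A Z X) Y.
Proof.
rewrite wE /ext_d2 !lieE !Dg !DJE !(JD, JN) !gE.
rewrite (gJ_skew Y (D X Z)) (gJ_skew X (D Y Z)) (gJ_skew X (D Z Y)) (gDJ Y X Z).
by ring.
Qed.

Let g0l Y : g 0 Y = 0.
Proof. by apply: (@addrI _ (g 0 Y)); rewrite -gDl !addr0. Qed.

(** By [d_omegaE] and [DJ_J], the right side is the left one plus four terms, which add up to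
    g(N_J(Y, Z), JX). *)
Lemma DJ_d_omega (N0 : forall X Y, nijenhuis lie J X Y = 0) X Y Z :
  g (A X Y) Z *+ 2 = w X Y Z - w X (J Y) (J Z).
Proof.
have := nijenhuis_DJ Y Z (J X); rewrite N0 g0l JJ !gNr => E.
rewrite !d_omegaE (DJ_J X Y) gNl gJ (DJ_J (J Y) Z) gNl -gJr (gDJJ (J Z)) (gDJ Z X).
by apply: (eq_lincomb E); ring.
Qed.

Let double_eq (x y : F) : x *+ 2 = y *+ 2 -> x = y.
Proof. exact: double_inj. Qed.

(** This follows from the cyclic sum of [DJ_d_omega], whose left sides add up to 2 d omega. The
    identity is the real form of type (2,1)+(1,2), as in [type_21_12E]. *)
Lemma d_omega_type (N0 : forall X Y, nijenhuis lie J X Y = 0) X Y Z :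
  w X Y Z = w (J X) (J Y) Z + w (J X) Y (J Z) + w X (J Y) (J Z).
Proof.
have cyc X' Y' Z' : w Y' Z' X' = w X' Y' Z' by rewrite !d_omegaE; ring.
have E1 := DJ_d_omega N0 X Y Z; have E2 := DJ_d_omega N0 Y Z X.
have E3 := DJ_d_omega N0 Z X Y.
rewrite (cyc X Y Z) (cyc (J X) Y (J Z)) in E2.
rewrite (cyc Y Z X) (cyc X Y Z) (cyc (J Y) Z (J X)) (cyc (J X) (J Y) Z) in E3.
apply: (eq_lincomb3 (esym E1) (esym E2) (esym E3)).
by rewrite (d_omegaE X Y Z); ring.
Qed.

Variable h : V -> V -> V -> F.
Hypothesis hDl : forall X X' Y Z, h (X + X') Y Z = h X Y Z + h X' Y Z.
Hypothesis h12 : forall X Y Z, h Y X Z = - h X Y Z.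
Hypothesis h23 : forall X Y Z, h X Z Y = - h X Y Z.

Let h13 X Y Z : h Z Y X = - h X Y Z.
Proof. by rewrite h12 h23 h12 !opprK. Qed.
Let hcyc X Y Z : h Y Z X = h X Y Z.
Proof. by rewrite h23 h12 opprK. Qed.
Let hN1 X Y Z : h (- X) Y Z = - h X Y Z.
Proof.
exact: (additive_opp (fun x => h x Y Z) (fun x y => hDl x y Y Z)).
Qed.
Let hN2 X Y Z : h X (- Y) Z = - h X Y Z.
Proof. by rewrite h12 hN1 h12 opprK. Qed.
Let hN3 X Y Z : h X Y (- Z) = - h X Y Z.
Proof. by rewrite h23 hN2 h23 opprK. Qed.

(** The first condition keeps brackets of graph sections in the graph ([graph_closed]), the second
    is the one in [parallelE]. The substitution of (JZ, Y, X) for (X, Y, Z), its inverse, and the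
    skewness of h exchange them. *)
Lemma twisted_condE :
  (forall X Y Z, h X Y Z - h (J X) (J Y) Z + g (A Z Y) (J X) *+ 2 = 0) <->
  (forall X Y Z, g (A X Y) Z *+ 2 = - (h X (J Y) Z + h X Y (J Z))).
Proof.
split=> B X Y Z.
  have := B (J Z) Y X; rewrite JJ hN1 gNr (h13 X Y (J Z)) (h13 X (J Y) Z) => E.
  by apply: (eq_lincomb (esym E)); ring.
have := B Z Y (J X); rewrite JJ hN3 (h13 (J X)) (h13 X Y Z) => ->.
by ring.
Qed.

(** [K] is (1/2) g^{-1} h. The commutator of D_X + K_X with J is A X + K_X J - J K_X, and twice its
    product with Z is 2 g(A X Y, Z) + h(X, JY, Z) + h(X, Y, JZ). *)
Lemma parallelE (K : V -> V -> V) : (forall X Y Z, g (K X Y) Z *+ 2 = h X Y Z) ->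
  (forall X Y, D X (J Y) + K X (J Y) = J (D X Y + K X Y)) <->
  (forall X Y Z, g (A X Y) Z *+ 2 = - (h X (J Y) Z + h X Y (J Z))).
Proof.
move=> gK; split=> [P X Y Z|B X Y].
  have := congr1 (fun U => g U Z) (P X Y).
  rewrite DJE JD !gE => E; rewrite -!gK gJr.
  by apply: (eq_lincomb2 E E); ring.
rewrite DJE JD [A X Y + _]addrC -addrA; congr (_ + _).
apply/eqP; rewrite -subr_eq0; apply/eqP/g_inj => Z.
apply: double_eq; rewrite mul0rn !gE.
by apply: (eq_lincomb (B X Y Z)); rewrite -!gK gJr; ring.
Qed.

(** Inserting the hypothesis into [nijenhuis_DJ] gives [NE]: lowered by g, the Nijenhuis tensor is
    exactly the defect in the type condition on h. *)
Lemma nijenhuis_type :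
  (forall X Y Z, g (A X Y) Z *+ 2 = - (h X (J Y) Z + h X Y (J Z))) ->
  (forall X Y, nijenhuis lie J X Y = 0) <->
  (forall X Y Z, h X Y Z = h (J X) (J Y) Z + h (J X) Y (J Z) + h X (J Y) (J Z)).
Proof.
move=> B.
have NE X Y Z : g (nijenhuis lie J X Y) Z =
    h (J X) (J Y) Z + h (J X) Y (J Z) + h X (J Y) (J Z) - h X Y Z.
  apply: double_eq; rewrite nijenhuis_DJ.
  have E1 := B Y X (J Z); have E2 := B X Y (J Z).
  have E3 := B (J X) Y Z; have E4 := B (J Y) X Z.
  rewrite !JJ !hN3 in E1 E2.
  rewrite !(mulrnDl, mulNrn) E1 E2 E3 E4.
  rewrite (h12 X Y) (h12 X (J Y)) (h12 (J X) Y) (h12 (J X) (J Y)).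
  by ring.
split=> [N0 X Y Z|T X Y].
  by apply: (eq_lincomb (NE X Y Z)); rewrite N0 g0l; ring.
by apply: g_inj => Z; rewrite NE (T X Y); ring.
Qed.

(** The second condition is four times - d^c omega = h on real vector fields ([dc_eq_opp_ctri]).
    With N_J = 0, each side forces h(X, Y, Z) = d omega(JX, JY, JZ), and the type condition recovers
    the other side from that. *)
Lemma twisted_d_omega : (forall X Y, nijenhuis lie J X Y = 0) ->
  (forall X Y Z, g (A X Y) Z *+ 2 = - (h X (J Y) Z + h X Y (J Z))) <->
  (forall X Y Z, w (J X) Y Z + w X (J Y) Z + w X Y (J Z)
                 + w (J X) (J Y) (J Z) *+ 3 = h X Y Z *+ 4).
Proof.
move=> N0; split=> [B X Y Z|C].
  have T := (nijenhuis_type B).1 N0.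
  (* Add the hypothesis cyclically, then use the type of h at (JX', Y', Z'). *)
  have wh X' Y' Z' : w X' Y' Z' = - h (J X') (J Y') (J Z').
    rewrite d_omegaE; apply: double_eq; rewrite !mulrnDl !B.
    have := T (J X') Y' Z'; rewrite JJ !hN1 => E.
    apply: (eq_lincomb2 (esym E) (esym E)).
    rewrite (hcyc X' Y' (J Z')) (hcyc Y' Z' (J X')) (hcyc (J X') Y' Z').
    by rewrite (hcyc (J Y') Z' X') (hcyc X' (J Y') Z'); ring.
  by rewrite !wh !JJ !(hN1, hN2, hN3) (T X Y Z); ring.
have wN1 X Y Z : w (- X) Y Z = - w X Y Z.
  by rewrite !d_omegaE DJNl DJNr !gNl gNr; ring.
have wC X Y Z : w Y X Z = - w X Y Z.
  by rewrite !d_omegaE (gDJ Y) (gDJ X Z) (gDJ Z); ring.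
have cyc X Y Z : w Y Z X = w X Y Z by rewrite !d_omegaE; ring.
have wN2 X Y Z : w X (- Y) Z = - w X Y Z by rewrite wC wN1 wC opprK.
have wN3 X Y Z : w X Y (- Z) = - w X Y Z by rewrite -cyc wN2 cyc.
have wT := d_omega_type N0.
(* The type of d omega at (JX, Y, Z) reduces the left side of [C] to 4 d omega(JX, JY, JZ). *)
have hE X Y Z : h X Y Z = w (J X) (J Y) (J Z).
  have E := wT (J X) Y Z; rewrite !JJ !wN1 in E.
  apply: double_eq; apply: double_eq.
  by apply: (eq_lincomb2 E (esym (C X Y Z))); ring.
move=> X Y Z; rewrite (DJ_d_omega N0) (wT X Y Z) !hE !JJ !(wN2, wN3).
by ring.
Qed.

End Hermitian.

(** * Complex trilinear maps *)

Section Trilinear.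
Variables (V W : zmodType).
Implicit Types (T : cplx V -> cplx V -> cplx V -> cplx W).

(** Complex linearity of maps on pairs is expressed by additivity and commutation with [imul], the
    multiplication by i. *)
Record trilinear T : Prop := {
  tri_D1 : forall X X' Y Z, T (X + X') Y Z = T X Y Z + T X' Y Z;
  tri_D2 : forall X Y Y' Z, T X (Y + Y') Z = T X Y Z + T X Y' Z;
  tri_D3 : forall X Y Z Z', T X Y (Z + Z') = T X Y Z + T X Y Z';
  tri_i1 : forall X Y Z, T (imul X) Y Z = imul (T X Y Z);
  tri_i2 : forall X Y Z, T X (imul Y) Z = imul (T X Y Z);
  tri_i3 : forall X Y Z, T X Y (imul Z) = imul (T X Y Z) }.

Lemma imulD {U : zmodType} (x y : cplx U) : imul (x + y) = imul x + imul y.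
Proof. by rewrite /imul /= opprD. Qed.

Lemma imulN {U : zmodType} (x : cplx U) : imul (- x) = - imul x.
Proof. by []. Qed.

Lemma cplx_decomp {U : zmodType} (x : cplx U) : x = (x.1, 0) + imul (x.2, 0).
Proof. by case: x => x1 x2; congr (_, _); rewrite /= ?oppr0 (addr0, add0r). Qed.

(** Every pair is x + iy with x, y real, so identities between complex forms need only be checked on
    real vector fields. *)
Lemma trilinear_ext T T' : trilinear T -> trilinear T' ->
  (forall X Y Z : V, T (X, 0) (Y, 0) (Z, 0) = T' (X, 0) (Y, 0) (Z, 0)) ->
  forall X Y Z, T X Y Z = T' X Y Z.
Proof.
move=> [D1 D2 D3 I1 I2 I3] [D1' D2' D3' I1' I2' I3'] E X Y Z.
rewrite (cplx_decomp X) (cplx_decomp Y) (cplx_decomp Z).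
rewrite !(D1, D2, D3, I1, I2, I3) !E.
by rewrite !(D1', D2', D3', I1', I2', I3').
Qed.

Lemma trilinearD T T' : trilinear T -> trilinear T' ->
  trilinear (fun X Y Z => T X Y Z + T' X Y Z).
Proof.
move=> [D1 D2 D3 I1 I2 I3] [D1' D2' D3' I1' I2' I3'].
split=> *; rewrite ?(D1, D2, D3, I1, I2, I3).
all: rewrite ?(D1', D2', D3', I1', I2', I3').
all: by rewrite (imulD, addrACA).
Qed.

Lemma trilinearN T : trilinear T -> trilinear (fun X Y Z => - T X Y Z).
Proof.
move=> [D1 D2 D3 I1 I2 I3]; split=> *; rewrite ?(D1, D2, D3, I1, I2, I3).
all: by rewrite (imulN, opprD).
Qed.

Lemma trilinear_imul T : trilinear T -> trilinear (fun X Y Z => imul (T X Y Z)).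
Proof.
move=> [D1 D2 D3 I1 I2 I3]; split=> *; rewrite ?(D1, D2, D3, I1, I2, I3).
all: by rewrite ?imulD.
Qed.

Definition clinear (f : cplx V -> cplx V) : Prop :=
  (forall x y, f (x + y) = f x + f y) /\ (forall x, f (imul x) = imul (f x)).

Lemma trilinear_comp T p q r : clinear p -> clinear q -> clinear r ->
  trilinear T -> trilinear (fun X Y Z => T (p X) (q Y) (r Z)).
Proof.
move=> [pD pI] [qD qI] [rD rI] [D1 D2 D3 I1 I2 I3].
by split=> *; rewrite ?(pD, pI, qD, qI, rD, rI) (D1, D2, D3, I1, I2, I3).
Qed.

End Trilinear.
Arguments trilinear {V W} T.
Arguments clinear {V} f.

Section CtriTrilinear.
Variables (V : zmodType) (W : comPzRingType) (T : V -> V -> V -> W).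
Hypothesis TD1 : forall X X' Y Z, T (X + X') Y Z = T X Y Z + T X' Y Z.
Hypothesis TD2 : forall X Y Y' Z, T X (Y + Y') Z = T X Y Z + T X Y' Z.
Hypothesis TD3 : forall X Y Z Z', T X Y (Z + Z') = T X Y Z + T X Y Z'.

Let TN1 X Y Z : T (- X) Y Z = - T X Y Z.
Proof. exact: (additive_opp (fun x => T x Y Z) (fun x y => TD1 x y Y Z)). Qed.
Let TN2 X Y Z : T X (- Y) Z = - T X Y Z.
Proof. exact: (additive_opp (fun x => T X x Z) (fun x y => TD2 X x y Z)). Qed.
Let TN3 X Y Z : T X Y (- Z) = - T X Y Z.
Proof. exact: (additive_opp (fun x => T X Y x) (fun x y => TD3 X Y x y)). Qed.

Lemma ctriE X Y Z : ctri T X Y Z =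
  (T X.1 Y.1 Z.1 - T X.1 Y.2 Z.2 - (T X.2 Y.1 Z.2 + T X.2 Y.2 Z.1),
   T X.1 Y.1 Z.2 + T X.1 Y.2 Z.1 + (T X.2 Y.1 Z.1 - T X.2 Y.2 Z.2)).
Proof. by []. Qed.

Lemma ctri_real X Y Z : ctri T (X, 0) (Y, 0) (Z, 0) = (T X Y Z, 0).
Proof.
have T01 Y' Z' : T 0 Y' Z' = 0 by apply: (@addrI _ (T 0 Y' Z')); rewrite -TD1 !addr0.
have T02 Y' Z' : T Y' 0 Z' = 0 by apply: (@addrI _ (T Y' 0 Z')); rewrite -TD2 !addr0.
have T03 Y' Z' : T Y' Z' 0 = 0 by apply: (@addrI _ (T Y' Z' 0)); rewrite -TD3 !addr0.
by rewrite ctriE /= !(T01, T02, T03) !(subr0, addr0).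
Qed.

Lemma ctri_trilinear : trilinear (ctri T).
Proof.
split=> *; rewrite !ctriE; congr (_, _); rewrite /= ?(TD1, TD2, TD3, TN1, TN2, TN3).
all: by ring.
Qed.

End CtriTrilinear.

(** * The Courant bracket *)

Section Courant.
Variables (R : realType) (m : nat) (M : manifold R m).
Local Notation F := (Cinf M).
Implicit Types (X Y Z : VF M) (xi : Form1 M) (f : F) (u v w : TT M).

Lemma halfFK : halfF M + halfF M = 1.
Proof.
apply/val_inj/funext => p; change ((2^-1 : R) + 2^-1 = 1).
by rewrite -mulr2n -[X in X *+ _]mulr1 -mulrnAr mulVf // pnatr_eq0.
Qed.

Lemma VF_D X f f' : X (f + f') = X f + X f'.
Proof. by have [+ _ _] := VFP X; apply. Qed.
Lemma VF_N X f : X (- f) = - X f.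
Proof. exact: (additive_opp X (VF_D X)). Qed.
Lemma VF_halfM X f : X (halfF M * f) = halfF M * X f.
Proof. by have [_ + _] := VFP X; apply. Qed.
Lemma Form1_D xi X Y : xi (X + Y) = xi X + xi Y.
Proof. by have := Form1P xi 1 X Y; rewrite !scale1r. Qed.
Lemma Form1_N xi X : xi (- X) = - xi X.
Proof. exact: (additive_opp xi (Form1_D xi)). Qed.
Lemma Form1_ext (xi eta : Form1 M) : (forall X, xi X = eta X) -> xi = eta.
Proof. by move=> E; apply/val_inj/funext. Qed.

Lemma VF_oppE X f : (- X) f = - X f. Proof. by []. Qed.
Lemma Form1_addE (xi eta : Form1 M) X : (xi + eta) X = xi X + eta X. Proof. by []. Qed.
Lemma Form1_oppE xi X : (- xi) X = - xi X. Proof. by []. Qed.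
Lemma Form1_scaleE f xi X : (f *: xi) X = f * xi X. Proof. by []. Qed.

Lemma lieC X Y : lie Y X = - lie X Y.
Proof. by apply: VF_ext => f; rewrite VF_oppE !lieE; ring. Qed.
Lemma lieDl X X' Y : lie (X + X') Y = lie X Y + lie X' Y.
Proof.
by apply: VF_ext => f; rewrite VF_addE !lieE !VF_addE VF_D; ring.
Qed.
Lemma lieDr X Y Y' : lie X (Y + Y') = lie X Y + lie X Y'.
Proof. by rewrite lieC lieDl opprD -!lieC. Qed.

Lemma TT_add1 u v : (u + v).1 = u.1 + v.1. Proof. by []. Qed.
Lemma TT_add2 u v : (u + v).2 = u.2 + v.2. Proof. by []. Qed.

Lemma courantE2 u v Z : (courant u v).2 Z =
  u.1 (v.2 Z) - v.2 (lie u.1 Z) - (v.1 (u.2 Z) - u.2 (lie v.1 Z))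
  - halfF M * Z (v.2 u.1 - u.2 v.1 : F).
Proof. by []. Qed.

Lemma TT_ext u v : u.1 = v.1 -> (forall Z, u.2 Z = v.2 Z) -> u = v.
Proof. by case: u v => [X xi] [Y eta] /= -> /Form1_ext ->. Qed.

Lemma courantC u v : courant v u = - courant u v.
Proof.
apply: TT_ext => [|Z]; first exact: lieC.
by rewrite Form1_oppE !courantE2 !VF_D !VF_N; ring.
Qed.

Lemma courantDl u u' v : courant (u + u') v = courant u v + courant u' v.
Proof.
apply: TT_ext => [|Z]; first exact: lieDl.
rewrite [RHS]Form1_addE !courantE2 TT_add1 TT_add2 lieDl.
by rewrite !Form1_D !Form1_addE !VF_addE !VF_D !VF_N !VF_D; ring.
Qed.

Lemma courantDr u v v' : courant u (v + v') = courant u v + courant u v'.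
Proof. by rewrite courantC courantDl opprD -!courantC. Qed.

Lemma courantNl u v : courant (- u) v = - courant u v.
Proof. exact: (additive_opp (fun x => courant x v) (fun x y => courantDl x y v)). Qed.
Lemma courantNr u v : courant u (- v) = - courant u v.
Proof. exact: (additive_opp (courant u) (courantDr u)). Qed.

Lemma pairingC u v : pairing u v = pairing v u.
Proof. by rewrite /pairing addrC. Qed.
Lemma pairingDl u u' v : pairing (u + u') v = pairing u v + pairing u' v.
Proof. by rewrite /pairing TT_add1 TT_add2 Form1_D !Form1_addE; ring. Qed.
Lemma pairingDr u v v' : pairing u (v + v') = pairing u v + pairing u v'.
Proof. by rewrite !(pairingC u) pairingDl. Qed.
Lemma pairingNl u v : pairing (- u) v = - pairing u v.
Proof. exact: (additive_opp (fun x => pairing x v) (fun x y => pairingDl x y v)). Qed.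
Lemma pairing_nondegenerate u : (forall v, pairing u v = 0) -> u = 0.
Proof.
have half_inj f : halfF M * f = 0 -> f = 0.
  by move=> E; rewrite -[f]mul1r -halfFK mulrDl E addr0.
have xi0 xi : xi (0 : VF M) = 0.
  by apply: (@addrI _ (xi 0)); rewrite -Form1_D !addr0.
move=> E; apply: TT_ext => [|Z].
  apply: VF_ext => f; have := E (0, d0 f).
  by rewrite /pairing /= xi0 add0r => /half_inj.
by have := E (Z, 0) => /half_inj; rewrite addr0.
Qed.

(** The Courant algebroid axiom u.1<v, w> = <[u, v] + d<u, v>, w> + <v, [u, w] + d<u, w>>, where
    <df, w> = (1/2) w.1(f). *)
Lemma courant_pairing u v w : pairing (courant u v) w + pairing (courant u w) v =
  u.1 (pairing v w) - halfF M * w.1 (pairing u v) - halfF M * v.1 (pairing u w).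
Proof.
rewrite /pairing !courantE2 /= !VF_halfM !VF_D !VF_N (lieC v.1 w.1) Form1_N.
(* The two sides differ by (1/2 + 1/2 - 1) k; [ring] does not know that 1/2 + 1/2 = 1. *)
pose k : F := halfF M * (v.1 (u.2 w.1) + w.1 (u.2 v.1)).
by apply: (eq_lincomb (congr1 (fun e => e * k) halfFK)); rewrite /k; ring.
Qed.

(** * The Courant-Nijenhuis tensor of an orthogonal structure *)

Section Orthogonal.
Variable J : {additive TT M -> TT M}.
Hypothesis Jorth : forall u v, pairing (J u) (J v) = pairing u v.
Hypothesis JJ : forall u, J (J u) = - u.

Lemma orth_skew u v : pairing (J u) v = - pairing u (J v).
Proof. by rewrite -Jorth JJ pairingNl. Qed.

Lemma nijenhuis_courantC u v :
  nijenhuis (@courant R m M) J v u = - nijenhuis (@courant R m M) J u v.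
Proof.
rewrite /nijenhuis (courantC u v) (courantC (J u) (J v)) (courantC (J u) v) (courantC u (J v)).
by rewrite -!opprD raddfN -opprD [courant (J u) v + _]addrC.
Qed.

(** Moving J across the pairing leaves four brackets paired with w or Jw. [courant_pairing] turns
    each one, added to its counterpart with v and w exchanged, into derivatives of pairings, and
    these cancel by orthogonality of J. *)
Lemma nijenhuis_courant_skew u v w :
  pairing (nijenhuis (@courant R m M) J u v) w =
  - pairing (nijenhuis (@courant R m M) J u w) v.
Proof.
have E1 := courant_pairing u v w; have E2 := courant_pairing (J u) (J v) w.
have E3 := courant_pairing u (J v) (J w); have E4 := courant_pairing (J u) v (J w).
rewrite !(Jorth, orth_skew, VF_N) in E1 E2 E3 E4.
have E34 := congr2 +%R E3 E4.
apply: (eq_lincomb3 E1 (esym E2) (esym E34)).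
by rewrite /nijenhuis !(pairingDl, pairingNl) !orth_skew !pairingDl; ring.
Qed.

End Orthogonal.

(** * The splitting into C+ and C-, and condition (i) *)

Section GeneralizedKahler.
Variables J1 J2 : {linear TT M -> TT M}.
Hypothesis hJ : almost_gen_kahler J1 J2.

Local Notation N := (nijenhuis (@courant R m M)).
Local Notation G := (gen_metric J1 J2).

Lemma courant_integrableE (J : {linear TT M -> TT M}) :
  (forall u, J (J u) = - u) ->
  courant_integrable (eigen_i J) <-> forall u v, N J u v = 0.
Proof. exact: (closed_eigenT J courantDl courantDr). Qed.

Let J1J1 u : J1 (J1 u) = - u. Proof. by case: hJ => -[]. Qed.
Let J2J2 u : J2 (J2 u) = - u. Proof. by case: hJ => _ -[]. Qed.
Let J1orth u v : pairing (J1 u) (J1 v) = pairing u v. Proof. by case: hJ => -[]. Qed.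
Let J2orth u v : pairing (J2 u) (J2 v) = pairing u v. Proof. by case: hJ => _ -[]. Qed.
Let J12 u : J1 (J2 u) = J2 (J1 u). Proof. by have [_ _ + _] := hJ; apply. Qed.

Let J1N u : J1 (- u) = - J1 u. Proof. exact: raddfN. Qed.
Let J2N u : J2 (- u) = - J2 u. Proof. exact: raddfN. Qed.

Let GJ1 u : G (J1 u) = J1 (G u).
Proof. by rewrite /gen_metric J1N -J12. Qed.
Let GN u : G (- u) = - G u.
Proof. by rewrite /gen_metric J2N J1N. Qed.
Let GK u : G (G u) = u.
Proof. by rewrite /gen_metric J2N J1N opprK -J12 J1J1 J2J2 opprK. Qed.
Let J2E u : J2 u = J1 (G u).
Proof. by rewrite /gen_metric J1N J1J1 opprK. Qed.

Lemma Cplus_J1 u : Cplus J1 J2 u -> Cplus J1 J2 (J1 u).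
Proof. by rewrite /Cplus /= GJ1 => ->. Qed.
Lemma Cplus_N u : Cplus J1 J2 u -> Cplus J1 J2 (- u).
Proof. by rewrite /Cplus /= GN => ->. Qed.
Lemma Cminus_J1 u : Cminus J1 J2 u -> Cminus J1 J2 (J1 u).
Proof. by rewrite /Cminus /= GJ1 => ->; rewrite J1N. Qed.
Lemma Cminus_N u : Cminus J1 J2 u -> Cminus J1 J2 (- u).
Proof. by rewrite /Cminus /= GN => ->. Qed.

Let GD u v : G (u + v) = G u + G v.
Proof. by rewrite /gen_metric !raddfD. Qed.
Let GZ f u : G (f *: u) = f *: G u.
Proof. by rewrite /gen_metric !linearZ /= scalerN. Qed.

Lemma Cplus_Cminus_decomp u :
  exists2 v, Cplus J1 J2 v & exists2 w, Cminus J1 J2 w & u = v + w.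
Proof.
exists (halfF M *: (u + G u)); first by rewrite /Cplus /= GZ GD GK addrC.
exists (halfF M *: (u - G u)); first by rewrite /Cminus /= GZ GD GN GK -scalerN opprB addrC.
by rewrite -scalerDr addrACA subrr addr0 scalerDr -scalerDl halfFK scale1r.
Qed.

Let pairing0l u : pairing 0 u = 0.
Proof. by apply: (@addrI _ (pairing 0 u)); rewrite -pairingDl !addr0. Qed.

(** For u in C+ and v in C-, test N(u, v) against w = w1 + w2. Total skewness brings u together with
    w1 in C+ and v together with w2 in C-, so the mixed values vanish as well. *)
Lemma nijenhuis_courant_split (J : {linear TT M -> TT M}) :
  (forall u v, pairing (J u) (J v) = pairing u v) -> (forall u, J (J u) = - u) ->
  (forall u v, Cplus J1 J2 u -> Cplus J1 J2 v -> N J u v = 0) ->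
  (forall u v, Cminus J1 J2 u -> Cminus J1 J2 v -> N J u v = 0) ->
  forall u v, N J u v = 0.
Proof.
move=> Jorth JJ Np Nm.
have NC := nijenhuis_courantC J.
have Nskew := nijenhuis_courant_skew J Jorth JJ.
have ND := nijenhuisDl J courantDl.
have NDr u v v' : N J u (v + v') = N J u v + N J u v'.
  by rewrite NC ND opprD -!NC.
have Npm u v : Cplus J1 J2 u -> Cminus J1 J2 v -> N J u v = 0.
  move=> Cu Cv; apply: pairing_nondegenerate => w.
  have [w1 Cw1 [w2 Cw2 ->]] := Cplus_Cminus_decomp w.
  rewrite pairingDr (Nskew u v w1) (Np u w1 Cu Cw1) (NC v u) pairingNl.
  by rewrite (Nskew v u) (Nm v w2 Cv Cw2) !pairing0l !oppr0 addr0.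
move=> u v; have [u1 Cu1 [u2 Cu2 ->]] := Cplus_Cminus_decomp u.
have [v1 Cv1 [v2 Cv2 ->]] := Cplus_Cminus_decomp v.
rewrite ND !NDr (Np u1 v1) // (Nm u2 v2) // (Npm u1 v2) // (NC v1 u2) (Npm v1 u2) //.
by rewrite oppr0 !addr0.
Qed.

(** J2 is J1 on C+ and -J1 on C-. For u, v in C+, N_J1 = 0 reads a = - J1 b and N_J2 = 0 reads a = -
    J2 b; if both hold, J1 b = J2 b, so b and a are in C+. Conversely, a in C+ and a = - J1 b put b
    = J1 a in C+, where J2 b = J1 b. On C- the signs of J2 are reversed. *)
Lemma gen_kahler_integrableE : gen_kahler_integrable J1 J2 <->
  (courant_integrable (L1plus J1 J2) /\ courant_integrable (L1minus J1 J2)).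
Proof.
rewrite /gen_kahler_integrable !courant_integrableE // /courant_integrable.
rewrite (closed_eigen J1 courantDl courantDr J1J1 Cplus_J1 Cplus_N).
rewrite (closed_eigen J1 courantDl courantDr J1J1 Cminus_J1 Cminus_N).
have J2p u : Cplus J1 J2 u -> J2 u = J1 u by rewrite J2E => ->.
have J2m u : Cminus J1 J2 u -> J2 u = - J1 u by rewrite J2E => ->; rewrite J1N.
split=> [[N1 N2]|[Lp Lm]].
  split=> u v Cu Cv; (split; first exact: N1).
    (* What remains of the criterion [closed_eigen] is membership of [a] in C+, resp. C-, which uses
       N_J2 = 0. *)
    1,2: pose a := courant u v - courant (J1 u) (J1 v).
    1,2: pose b := courant u (J1 v) + courant (J1 u) v.
    have := N1 u v; have := N2 u v; rewrite /nijenhuis (J2p u) // (J2p v) //.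
    rewrite -/a -/b => /eqP; rewrite addr_eq0 => /eqP E2 /eqP.
    rewrite addr_eq0 => /eqP E1.
    have E : J1 b = J2 b by apply: oppr_inj; rewrite -E1 E2.
    by rewrite /Cplus /= /gen_metric E1 J2N J1N opprK {1}E J2J2 J1N.
  have := N1 u v; have := N2 u v; rewrite /nijenhuis (J2m u) // (J2m v) //.
  rewrite courantNl courantNr opprK courantNr courantNl -opprD J2N.
  rewrite -/a -/b => /eqP; rewrite subr_eq0 => /eqP E2 /eqP.
  rewrite addr_eq0 => /eqP E1.
  by rewrite /Cminus /= /gen_metric {1}E2 J2J2 J1N opprK E1 opprK.
split; apply: nijenhuis_courant_split => // u v Cu Cv.
all: pose a := courant u v - courant (J1 u) (J1 v).
all: pose b := courant u (J1 v) + courant (J1 u) v.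
- by have [] := Lp u v Cu Cv.
- by have [] := Lm u v Cu Cv.
- have [+ +] := Lp u v Cu Cv; rewrite /nijenhuis (J2p u) // (J2p v) //.
  rewrite -/a -/b => /eqP; rewrite addr_eq0 => /eqP E1 Ca.
  have Eb : b = J1 a by rewrite E1 J1N J1J1 opprK.
  by rewrite Eb -J12 (J2p a) // J1J1 subrr.
- have [+ +] := Lm u v Cu Cv; rewrite /nijenhuis (J2m u) // (J2m v) //.
  rewrite courantNl courantNr opprK courantNr courantNl -opprD J2N.
  rewrite -/a -/b => /eqP; rewrite addr_eq0 => /eqP E1 Ca.
  have Eb : b = J1 a by rewrite E1 J1N J1J1 opprK.
  by rewrite Eb -J12 (J2m a) // J1N J1J1 opprK subrr.
Qed.

End GeneralizedKahler.

(** * Exterior derivatives of 2-forms *)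

Section TwoForms.
Variable a : VF M -> VF M -> F.
Hypothesis aDl : forall X X' Y, a (X + X') Y = a X Y + a X' Y.
Hypothesis aC : forall X Y, a Y X = - a X Y.

Let aDr X Y Y' : a X (Y + Y') = a X Y + a X Y'.
Proof. by rewrite aC aDl opprD -!(aC _ X). Qed.

Lemma d2Dl X X' Y Z : d2 a (X + X') Y Z = d2 a X Y Z + d2 a X' Y Z.
Proof.
by rewrite /d2 /ext_d2 !lieDl !(aDl, aDr) VF_addE !VF_D; ring.
Qed.

Let aNl X Y : a (- X) Y = - a X Y.
Proof. exact: (additive_opp (fun x => a x Y) (fun x y => aDl x y Y)). Qed.

Lemma d2_swap12 X Y Z : d2 a Y X Z = - d2 a X Y Z.
Proof.
rewrite /d2 /ext_d2 (lieC X Y) aNl (aC X Y) VF_N.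
by ring.
Qed.

Lemma d2_swap23 X Y Z : d2 a X Z Y = - d2 a X Y Z.
Proof.
rewrite /d2 /ext_d2 (lieC Y Z) aNl (aC Y Z) VF_N.
by ring.
Qed.

End TwoForms.

Lemma is_2form_skew (b : {linear VF M -> Form1 M}) : is_2form b -> forall X Y, b Y X = - b X Y.
Proof.
move=> b0 X Y; have := b0 (X + Y).
rewrite raddfD Form1_addE !Form1_D !b0 add0r addr0 => /eqP.
by rewrite addrC addr_eq0 => /eqP.
Qed.

End Courant.

(** * The operator d^c and types of forms *)

Section Dc.
Variables (R : realType) (m : nat) (M : manifold R m).
Local Notation F := (Cinf M).
Implicit Types (X Y Z : VF M) (f : F).

Lemma additive_halfF (f : VF M -> F) : (forall X Y, f (X + Y) = f X + f Y) ->
  forall X, f (halfF M *: X) = halfF M * f X.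
Proof.
move=> fD X; have -> : f X = f (halfF M *: X) + f (halfF M *: X).
  by rewrite -fD -scalerDl halfFK scale1r.
by rewrite -[LHS]mul1r -halfFK; ring.
Qed.

Section Dolbeault.
Variable J : {linear VF M -> VF M}.
Hypothesis JJ : forall X, J (J X) = - X.

Local Notation P := (proj_type J true).
Local Notation Q := (proj_type J false).

Let JN X : J (- X) = - J X. Proof. exact: raddfN. Qed.
Let JD X Y : J (X + Y) = J X + J Y. Proof. exact: raddfD. Qed.

Lemma clinear_proj_type s : clinear (proj_type J s).
Proof.
have imulZ f (x : cplx (VF M)) : imul (f *: x) = f *: imul x.
  by rewrite /imul; congr (_, _); rewrite -scalerN.
have JDc (x y : cplx (VF M)) : cmap J (x + y) = cmap J x + cmap J y.
  by rewrite /cmap /= !JD.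
have JIc (x : cplx (VF M)) : cmap J (imul x) = imul (cmap J x).
  by rewrite /cmap /imul /= JN.
split=> [x y|x]; rewrite /proj_type; case: s.
- by rewrite -scalerDr JDc imulD opprD addrACA.
- by rewrite -scalerDr JDc imulD addrACA.
- by rewrite imulZ JIc imulD imulN.
- by rewrite imulZ JIc imulD.
Qed.

Lemma sum_bool_cond {W : zmodType} (p : pred bool) (f : bool -> W) :
  \sum_(s : bool | p s) f s =
  (if p true then f true else 0) + (if p false then f false else 0).
Proof. by rewrite big_mkcond big_bool. Qed.

Lemma comp3_1 T (X Y Z : cplx (VF M)) : comp3 J 1 T X Y Z =
  T (P X) (Q Y) (Q Z) + (T (Q X) (P Y) (Q Z) + T (Q X) (Q Y) (P Z)).
Proof. by rewrite /comp3 !sum_bool_cond /= !(add0r, addr0). Qed.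

Lemma comp3_2 T (X Y Z : cplx (VF M)) : comp3 J 2 T X Y Z =
  T (P X) (P Y) (Q Z) + T (P X) (Q Y) (P Z) + T (Q X) (P Y) (P Z).
Proof. by rewrite /comp3 !sum_bool_cond /= !(add0r, addr0). Qed.

(** * Dolbeault operators on J-invariant 2-forms *)

Section Forms.
Variable a : VF M -> VF M -> F.
Hypothesis aDl : forall X X' Y, a (X + X') Y = a X Y + a X' Y.
Hypothesis aC : forall X Y, a Y X = - a X Y.
Hypothesis aJ : forall X Y, a (J X) (J Y) = a X Y.

Let aDr X Y Y' : a X (Y + Y') = a X Y + a X Y'.
Proof. by rewrite aC aDl opprD -!(aC _ X). Qed.
Let aNl X Y : a (- X) Y = - a X Y.
Proof. exact: (additive_opp (fun x => a x Y) (fun x y => aDl x y Y)). Qed.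
Let aNr X Y : a X (- Y) = - a X Y.
Proof. by rewrite aC aNl -aC. Qed.

Lemma cd2_cbil (X Y Z : cplx (VF M)) : cd2 (cbil a) X Y Z = ctri (d2 a) X Y Z.
Proof.
case: X Y Z => [X1 X2] [Y1 Y2] [Z1 Z2].
rewrite ctriE /= /cd2 /d2 /ext_d2 /cbil /cmap /imul /=.
by congr (_, _); rewrite /= !(aDl, aDr, aNl, aNr, VF_addE, VF_oppE, VF_D, VF_N); ring.
Qed.

Let a_half_l X Y : a (halfF M *: X) Y = halfF M * a X Y.
Proof. exact: (additive_halfF (fun x => a x Y) (fun x y => aDl x y Y)). Qed.
Let a_half_r X Y : a X (halfF M *: Y) = halfF M * a X Y.
Proof. exact: (additive_halfF (a X) (aDr X)). Qed.
Let aJr X Y : a X (J Y) = - a (J X) Y.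
Proof. by rewrite -aJ JJ aNr. Qed.

Let PE (X : cplx (VF M)) :
  P X = (halfF M *: (X.1 + J X.2), halfF M *: (X.2 - J X.1)).
Proof. by rewrite /proj_type /imul /cmap; congr (_, _); rewrite /= ?opprK. Qed.
Let QE (X : cplx (VF M)) :
  Q X = (halfF M *: (X.1 - J X.2), halfF M *: (X.2 + J X.1)).
Proof. by []. Qed.

Let cbilE (X Y : cplx (VF M)) :
  cbil a X Y = (a X.1 Y.1 - a X.2 Y.2, a X.1 Y.2 + a X.2 Y.1).
Proof. by []. Qed.

Let aE := (aDl, aDr, aNl, aNr, a_half_l, a_half_r, aJ, aJr).

(** A J-invariant 2-form is of type (1,1), so [del] and [delbar] of it are single components of its
    exterior derivative. *)
Lemma comp2_0 : comp2 J 0 (cbil a) = (fun _ _ => 0).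
Proof.
apply/funext => X; apply/funext => Y.
rewrite /comp2 !sum_bool_cond /= !(add0r, addr0) !QE cbilE.
by congr (_, _); rewrite /= !aE; ring.
Qed.

Lemma comp2_2 : comp2 J 2 (cbil a) = (fun _ _ => 0).
Proof.
apply/funext => X; apply/funext => Y.
rewrite /comp2 !sum_bool_cond /= !(add0r, addr0) !PE cbilE.
by congr (_, _); rewrite /= !aE; ring.
Qed.

Lemma comp2_1 : comp2 J 1 (cbil a) = cbil a.
Proof.
apply/funext => X; apply/funext => Y.
rewrite /comp2 !sum_bool_cond /= !(add0r, addr0) !PE !QE !cbilE.
(* The projections bring factors 1/2 on the left; the right side is multiplied by (1/2 + 1/2)^2 to
   match them. *)
have E (f : F) : f = (halfF M + halfF M) * ((halfF M + halfF M) * f).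
  by rewrite halfFK !mul1r.
by congr (_, _); rewrite /= [RHS]E !aE; ring.
Qed.

Let cd2_0 : cd2 (fun _ _ : cplx (VF M) => 0) = (fun _ _ _ => 0 : cplx F).
Proof.
apply/funext => X; apply/funext => Y; apply/funext => Z.
have V0 (U : VF M) : U 0 = 0 by apply: (@addrI _ (U 0)); rewrite -VF_D !addr0.
have c0 (U : cplx (VF M)) : cbil (fun (X : VF M) (f : F) => X f) U 0 = 0.
  by rewrite /cbil /cmap /imul /= !V0; congr (_, _); rewrite /= ?oppr0 addr0.
by rewrite /cd2 /ext_d2 !c0 !(subr0, addr0).
Qed.

Let comp3_0 p (X Y Z : cplx (VF M)) : comp3 J p (fun _ _ _ => 0 : cplx F) X Y Z = 0.
Proof. by rewrite /comp3 big1 // => s _; rewrite big1 // => t _; rewrite big1. Qed.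

Let cd2E : cd2 (cbil a) = ctri (d2 a).
Proof. by apply/funext => X; apply/funext => Y; apply/funext => Z; rewrite cd2_cbil. Qed.

Lemma delE (X Y Z : cplx (VF M)) : del J (cbil a) X Y Z = comp3 J 2 (ctri (d2 a)) X Y Z.
Proof.
rewrite /del !big_ord_recl big_ord0 /= /bump /= add1n.
by rewrite comp2_0 comp2_1 comp2_2 cd2_0 cd2E !comp3_0 add0r !addr0.
Qed.

Lemma delbarE (X Y Z : cplx (VF M)) : delbar J (cbil a) X Y Z = comp3 J 1 (ctri (d2 a)) X Y Z.
Proof.
rewrite /delbar !big_ord_recl big_ord0 /= /bump /= add1n.
by rewrite comp2_0 comp2_1 comp2_2 cd2_0 cd2E !comp3_0 add0r !addr0.
Qed.

End Forms.

(** * Type components of real 3-forms *)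

Section RealTrilinear.
Variable T : VF M -> VF M -> VF M -> F.
Hypothesis TD1 : forall X X' Y Z, T (X + X') Y Z = T X Y Z + T X' Y Z.
Hypothesis T12 : forall X Y Z, T Y X Z = - T X Y Z.
Hypothesis T23 : forall X Y Z, T X Z Y = - T X Y Z.

Let TD2 X Y Y' Z : T X (Y + Y') Z = T X Y Z + T X Y' Z.
Proof. by rewrite T12 TD1 opprD -!(T12 _ X). Qed.
Let TD3 X Y Z Z' : T X Y (Z + Z') = T X Y Z + T X Y Z'.
Proof. by rewrite T23 TD2 opprD -!(T23 X _ Y). Qed.
Let TN1 X Y Z : T (- X) Y Z = - T X Y Z.
Proof. exact: (additive_opp (fun x => T x Y Z) (fun x y => TD1 x y Y Z)). Qed.
Let TN2 X Y Z : T X (- Y) Z = - T X Y Z.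
Proof. exact: (additive_opp (fun x => T X x Z) (fun x y => TD2 X x y Z)). Qed.
Let TN3 X Y Z : T X Y (- Z) = - T X Y Z.
Proof. exact: (additive_opp (T X Y) (TD3 X Y)). Qed.
Let Th1 X Y Z : T (halfF M *: X) Y Z = halfF M * T X Y Z.
Proof. exact: (additive_halfF (fun x => T x Y Z) (fun x y => TD1 x y Y Z)). Qed.
Let Th2 X Y Z : T X (halfF M *: Y) Z = halfF M * T X Y Z.
Proof. exact: (additive_halfF (fun x => T X x Z) (fun x y => TD2 X x y Z)). Qed.
Let Th3 X Y Z : T X Y (halfF M *: Z) = halfF M * T X Y Z.
Proof. exact: (additive_halfF (T X Y) (TD3 X Y)). Qed.

Let J0 : J 0 = 0. Proof. exact: raddf0. Qed.
Let PE X : P (X, 0) = (halfF M *: X, - (halfF M *: J X)).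
Proof.
rewrite /proj_type /imul /cmap /= J0.
by congr (_, _); rewrite /= ?(opprK, oppr0, addr0, add0r) ?scalerN.
Qed.
Let QE X : Q (X, 0) = (halfF M *: X, halfF M *: J X).
Proof.
rewrite /proj_type /imul /cmap /= J0.
by congr (_, _); rewrite /= ?(opprK, oppr0, addr0, add0r) ?scalerN.
Qed.

Let T_tri := ctri_trilinear _ _ T TD1 TD2 TD3.

Let proj_trilinear s t u : trilinear (fun X Y Z : cplx (VF M) =>
  ctri T (proj_type J s X) (proj_type J t Y) (proj_type J u Z)).
Proof.
exact: (trilinear_comp _ _ _ _ _ _ (clinear_proj_type s) (clinear_proj_type t)
  (clinear_proj_type u) T_tri).
Qed.

Lemma comp3_1_trilinear : trilinear (comp3 J 1 (ctri T)).
Proof.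
have -> : comp3 J 1 (ctri T) = (fun X Y Z : cplx (VF M) =>
    ctri T (P X) (Q Y) (Q Z) + (ctri T (Q X) (P Y) (Q Z) + ctri T (Q X) (Q Y) (P Z))).
  by apply/funext => X; apply/funext => Y; apply/funext => Z; rewrite comp3_1.
by apply: trilinearD => //; exact: trilinearD.
Qed.

Lemma comp3_2_trilinear : trilinear (comp3 J 2 (ctri T)).
Proof.
have -> : comp3 J 2 (ctri T) = (fun X Y Z : cplx (VF M) =>
    ctri T (P X) (P Y) (Q Z) + ctri T (P X) (Q Y) (P Z) + ctri T (Q X) (P Y) (P Z)).
  by apply/funext => X; apply/funext => Y; apply/funext => Z; rewrite comp3_2.
by apply: trilinearD => //; exact: trilinearD.
Qed.

Let TE := (TN1, TN2, TN3, Th1, Th2, Th3).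

(** The three projections give the factor 1/8, and each J a factor i or -i. The (2,1) component in
    [comp3_2_real] is the complex conjugate of this one. *)
Lemma comp3_1_real X Y Z : comp3 J 1 (ctri T) (X, 0) (Y, 0) (Z, 0) =
  (halfF M * halfF M * halfF M *
     (T X Y Z *+ 3 + (T (J X) (J Y) Z + T (J X) Y (J Z) + T X (J Y) (J Z))),
   halfF M * halfF M * halfF M *
     (T (J X) Y Z + T X (J Y) Z + T X Y (J Z) + T (J X) (J Y) (J Z) *+ 3)).
Proof.
rewrite comp3_1 !PE !QE !ctriE /=.
by congr (_, _); rewrite /= !TE; ring.
Qed.

Lemma comp3_2_real X Y Z : comp3 J 2 (ctri T) (X, 0) (Y, 0) (Z, 0) =
  (halfF M * halfF M * halfF M *
     (T X Y Z *+ 3 + (T (J X) (J Y) Z + T (J X) Y (J Z) + T X (J Y) (J Z))),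
   - (halfF M * halfF M * halfF M) *
     (T (J X) Y Z + T X (J Y) Z + T X Y (J Z) + T (J X) (J Y) (J Z) *+ 3)).
Proof.
rewrite comp3_2 !PE !QE !ctriE /=.
by congr (_, _); rewrite /= !TE; ring.
Qed.

Let ctriT_real X Y Z := ctri_real _ _ T TD1 TD2 TD3 X Y Z.

(** On real vector fields the two components are conjugate, so their sum is real: it is (3T + S)/4,
    with S the right-hand side, and it equals T iff T = S. *)
Lemma type_21_12E : type_21_12 J T <->
  (forall X Y Z, T X Y Z = T (J X) (J Y) Z + T (J X) Y (J Z) + T X (J Y) (J Z)).
Proof.
have E X Y Z : comp3 J 2 (ctri T) (X, 0) (Y, 0) (Z, 0) +
    comp3 J 1 (ctri T) (X, 0) (Y, 0) (Z, 0) =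
    (halfF M * halfF M *
      (T X Y Z *+ 3 + (T (J X) (J Y) Z + T (J X) Y (J Z) + T X (J Y) (J Z))), 0).
  rewrite comp3_1_real comp3_2_real; set k := halfF M; set t := _ *+ 3 + _.
  have kk : k + k = 1 by exact: halfFK.
  congr (_, _); rewrite /=; last by ring.
  by apply: (eq_lincomb (congr1 (fun c => c * (k * k * t)) kk)); ring.
have kk : halfF M + halfF M = 1 by exact: halfFK.
split=> [H X Y Z|H].
  have := H (X, 0) (Y, 0) (Z, 0); rewrite E ctriT_real => /(congr1 fst) /= E1.
  move: E1; set k := halfF M in kk *; set t := T X Y Z; set e := _ + _ + _ => E1.
  pose s := t *+ 3 + e.
  (* Four times [E1] reads 4t = 4k^2 s; the other two relations replace 4k^2 = (k + k)^2 by 1. *)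
  apply: (eq_lincomb3 (congr1 (fun c => c *+ 4) E1) (congr1 (fun c => c * ((k + k) * s)) kk)
    (congr1 (fun c => c * s) kk)).
  by rewrite /s; ring.
apply: trilinear_ext => //.
  by apply: trilinearD; [exact: comp3_2_trilinear|exact: comp3_1_trilinear].
move=> X Y Z; rewrite E -H ctriT_real; congr (_, _).
rewrite -[LHS]mul1r -kk -[LHS]mul1r -kk.
by ring.
Qed.

End RealTrilinear.

(** * The operator d^c on real vector fields *)

Section DcReal.
Variable a : VF M -> VF M -> F.
Hypothesis aDl : forall X X' Y, a (X + X') Y = a X Y + a X' Y.
Hypothesis aC : forall X Y, a Y X = - a X Y.
Hypothesis aJ : forall X Y, a (J X) (J Y) = a X Y.

Lemma dc_trilinear : trilinear (dc J (cbil a)).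
Proof.
have -> : dc J (cbil a) =
    (fun X Y Z : cplx (VF M) =>
      imul (comp3 J 1 (ctri (d2 a)) X Y Z - comp3 J 2 (ctri (d2 a)) X Y Z)).
  apply/funext => X; apply/funext => Y; apply/funext => Z.
  by rewrite /dc delE // delbarE.
have D1 := d2Dl _ _ _ a aDl aC; have D12 := d2_swap12 _ _ _ a aDl aC.
have D23 := d2_swap23 _ _ _ a aDl aC.
apply: trilinear_imul; apply: trilinearD; first exact: comp3_1_trilinear.
by apply: trilinearN; exact: comp3_2_trilinear.
Qed.

(** The components [delbar] and [del] are conjugate, so i times their difference is -2 times the
    imaginary part of [comp3_1_real], whence the factor -2/8 = -1/4. *)
Lemma dc_real X Y Z : dc J (cbil a) (X, 0) (Y, 0) (Z, 0) =
  (- (halfF M * halfF M * (d2 a (J X) Y Z + d2 a X (J Y) Z + d2 a X Y (J Z)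
                         + d2 a (J X) (J Y) (J Z) *+ 3)), 0).
Proof.
have D1 := d2Dl _ _ _ a aDl aC; have D12 := d2_swap12 _ _ _ a aDl aC.
have D23 := d2_swap23 _ _ _ a aDl aC.
rewrite /dc delE // delbarE // comp3_1_real // comp3_2_real //.
set k := halfF M; set s := _ + _ *+ 3; set t := _ *+ 3 + _.
have kk : k + k = 1 by exact: halfFK.
congr (_, _); rewrite /=; last by ring.
by apply: (eq_lincomb (congr1 (fun c => - (c * (k * k * s))) kk)); ring.
Qed.

Lemma d2N X Y Z : d2 (fun X Y => - a X Y) X Y Z = - d2 a X Y Z.
Proof. by rewrite /d2 /ext_d2 !VF_N; ring. Qed.

Section Equations.
Variable h : VF M -> VF M -> VF M -> F.
Hypothesis hD1 : forall X X' Y Z, h (X + X') Y Z = h X Y Z + h X' Y Z.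
Hypothesis h12 : forall X Y Z, h Y X Z = - h X Y Z.
Hypothesis h23 : forall X Y Z, h X Z Y = - h X Y Z.

Let hD2 X Y Y' Z : h X (Y + Y') Z = h X Y Z + h X Y' Z.
Proof. by rewrite h12 hD1 opprD -!(h12 _ X). Qed.
Let hD3 X Y Z Z' : h X Y (Z + Z') = h X Y Z + h X Y Z'.
Proof. by rewrite h23 hD2 opprD -!(h23 X _ Y). Qed.

Local Notation e13 X Y Z :=
  (d2 a (J X) Y Z + d2 a X (J Y) Z + d2 a X Y (J Z) + d2 a (J X) (J Y) (J Z) *+ 3).

Let quarter (s t : F) : - (halfF M * halfF M * s) = t <-> s = - (t *+ 4).
Proof.
have kk : halfF M + halfF M = 1 by exact: halfFK.
split=> [<-|->].
  by rewrite -[LHS]mul1r -kk -[LHS]mul1r -kk; ring.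
by rewrite -[RHS]mul1r -kk -[RHS]mul1r -kk; ring.
Qed.

Lemma dc_eq_opp_ctri :
  (forall X Y Z : cplx (VF M), - dc J (cbil a) X Y Z = ctri h X Y Z) <->
  (forall X Y Z, e13 X Y Z = h X Y Z *+ 4).
Proof.
split=> [H X Y Z|H].
  have := H (X, 0) (Y, 0) (Z, 0).
  rewrite dc_real (ctri_real _ _ h hD1 hD2 hD3) => /(congr1 fst) /= /(congr1 -%R).
  by rewrite opprK => /quarter; rewrite mulNrn opprK.
apply: trilinear_ext => [||X Y Z]; first exact/trilinearN/dc_trilinear.
  exact: ctri_trilinear.
rewrite dc_real (ctri_real _ _ h hD1 hD2 hD3); congr (_, _); rewrite /= ?oppr0 //.
by rewrite -[RHS]opprK; congr (- _); apply/quarter; rewrite mulNrn opprK.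
Qed.

End Equations.
End DcReal.

Lemma dcN (a : VF M -> VF M -> F) :
  (forall X X' Y, a (X + X') Y = a X Y + a X' Y) ->
  (forall X Y, a Y X = - a X Y) -> (forall X Y, a (J X) (J Y) = a X Y) ->
  forall X Y Z : cplx (VF M),
    dc J (cbil (fun X Y => - a X Y)) X Y Z = - dc J (cbil a) X Y Z.
Proof.
move=> aDl aC aJ.
have bDl X X' Y : - a (X + X') Y = - a X Y - a X' Y by rewrite aDl opprD.
have bC X Y : - a Y X = - - a X Y by rewrite aC.
have bJ X Y : - a (J X) (J Y) = - a X Y by rewrite aJ.
apply: trilinear_ext => [||X Y Z]; first exact: (dc_trilinear _ bDl bC bJ).
  exact/trilinearN/dc_trilinear.
rewrite (dc_real _ bDl bC bJ) dc_real // !d2N.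
by congr (_, _); rewrite /= ?oppr0 //; ring.
Qed.

End Dolbeault.

End Dc.

(** * Closedness of the eigenbundle over a graph *)

(* To be used with the metric for C+ and with its opposite for C-. *)
Section GraphBundle.
Variables (R : realType) (m : nat) (M : manifold R m).
Local Notation F := (Cinf M).
Implicit Types (X Y Z : VF M) (f : F) (u v w : TT M).
Variables (J1 : {linear TT M -> TT M}) (C : set (TT M)).
Variables (b g : {linear VF M -> Form1 M}) (J : {linear VF M -> VF M}).
Variable nabla : VF M -> VF M -> VF M.
Hypothesis J1J1 : forall u, J1 (J1 u) = - u.
Hypothesis CE : forall u, C u <-> u.2 = b u.1 + g u.1.
Hypothesis CJ1 : forall u, C u -> C (J1 u).
Hypothesis JE : forall u, C u -> J u.1 = (J1 u).1.
Hypothesis b0 : is_2form b.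
Hypothesis gC : forall X Y, g X Y = g Y X.
Hypothesis g_inj : forall X, (forall Y, g X Y = 0) -> X = 0.
Hypothesis J1orth : forall u v, pairing (J1 u) (J1 v) = pairing u v.
Hypothesis hnabla : levi_civita g nabla.

Local Notation h := (d2 (fun X Y => b X Y)).
Local Notation gr X := (X, b X + g X).

Let bC := is_2form_skew _ _ _ b b0.
Let bDl X X' Y : b (X + X') Y = b X Y + b X' Y.
Proof. by rewrite raddfD. Qed.
Let gDl X X' Y : g (X + X') Y = g X Y + g X' Y.
Proof. by rewrite raddfD. Qed.

Let Cgr X : C (gr X). Proof. exact/CE. Qed.
Let J1gr X : J1 (gr X) = gr (J X).
Proof.
have := CJ1 _ (Cgr X) => /CE.
by rewrite -(JE _ (Cgr X)) /=; case: (J1 _) (JE _ (Cgr X)) => ? ? /= -> ->.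
Qed.

Lemma graph_JJ X : J (J X) = - X.
Proof. by have /(congr1 fst) := J1J1 (gr X); rewrite !J1gr. Qed.

(** The pairing restricts to g on the graph because b is skew, and J1 acts on the graph as J. *)
Lemma graph_gJ X Y : g (J X) (J Y) = g X Y.
Proof.
have pgr U V : pairing (gr U) (gr V) = g U V.
  transitivity (halfF M * (b U V + g U V + (b V U + g V U)) : F) => //.
  rewrite (bC U V) (gC V U).
  by apply: (eq_lincomb (congr1 (fun e => e * g U V) (halfFK _ _ M))); ring.
by rewrite -!pgr -!J1gr J1orth.
Qed.

(** The terms in b assemble into i_{[X,Y]} b and h = db. The terms in g leave the left side of
    [lie_torsion_free] as deviation from the graph. *)
Lemma courant_graph X Y Z : (courant (gr X) (gr Y)).2 Z =
  (b (lie X Y) + g (lie X Y)) Z + h X Y Z +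
  (X (g Y Z) - g Y (lie X Z) - (Y (g X Z) - g X (lie Y Z)) - g (lie X Y) Z).
Proof.
transitivity (X (b Y Z + g Y Z) - (b Y (lie X Z) + g Y (lie X Z))
  - (Y (b X Z + g X Z) - (b X (lie Y Z) + g X (lie Y Z)))
  - halfF M * Z (b Y X + g Y X - (b X Y + g X Y)) : F) => //.
rewrite /d2 /ext_d2 Form1_addE (gC Y X) (bC X Y) !(VF_D, VF_N).
rewrite (bC X (lie Y Z)) (bC Y (lie X Z)).
(* The exact term of the Courant bracket contributes (1/2 + 1/2) Z(b(X, Y)); its g part cancels by
   symmetry. *)
pose k : F := Z (b X Y).
by apply: (eq_lincomb (congr1 (fun e => e * k) (halfFK _ _ M))); rewrite /k; ring.
Qed.

Let A X Y := nabla X (J Y) - J (nabla X Y).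
Let act X f : F := X f.

Let actD X f f' : act X (f + f') = act X f + act X f'. Proof. exact: VF_D. Qed.
Let nablaDl X X' Y : nabla (X + X') Y = nabla X Y + nabla X' Y.
Proof. by have := lc_linl hnabla 1 X X' Y; rewrite !scale1r. Qed.
Let nablaDr := lc_addr hnabla.
Let nabla_g X Y Z : act X (g Y Z) = g (nabla X Y) Z + g Y (nabla X Z).
Proof. exact: lc_metric. Qed.
Let nabla_lie X Y : lie X Y = nabla X Y - nabla Y X.
Proof. exact: (esym (lc_torsion hnabla X Y)). Qed.
Let AE X Y : A X Y = nabla X (J Y) - J (nabla X Y). Proof. by []. Qed.
Let hDl := d2Dl _ _ _ _ bDl bC.
Let h12 := d2_swap12 _ _ _ _ bDl bC.
Let h23 := d2_swap23 _ _ _ _ bDl bC.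

(** This is parallelism of J for nabla + (1/2) g^{-1} h, tested against Z ([graph_parallel]). *)
Definition twisted_parallel :=
  forall X Y Z, g (nabla X (J Y) - J (nabla X Y)) Z *+ 2 =
                - (h X (J Y) Z + h X Y (J Z)).

(** In the criterion [closed_eigen], membership of [u, v] - [Ju, Jv] in the graph is
    [twisted_parallel]. Granted that, N_J1 takes values in the graph, hence vanishes iff its vector
    part N_J does. *)
Lemma graph_closed :
  closed_under (cbil (@courant R m M)) (eigen_i J1 `&` csub C) <->
  (forall X Y, nijenhuis (@lie R m M) J X Y = 0) /\ twisted_parallel.
Proof.
have CN u : C u -> C (- u).
  move=> /CE Cu; apply/CE; change (- u.2 = b (- u.1) + g (- u.1)).
  by rewrite Cu opprD (raddfN b) (raddfN g).
have S X Y Z := lie_torsion_free F (VF M) act nabla (fun X Y => g X Y) gDl gC nabla_g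
  (@lie R m M) nabla_lie X Y Z.
have T X Y Z := lie_twist F (VF M) act nabla (fun X Y => g X Y) J actD nablaDr gDl gC nabla_g
  graph_JJ graph_gJ A AE X Y Z.
have E : (forall X Y Z, h X Y Z - h (J X) (J Y) Z + g (A Z Y) (J X) *+ 2 = 0) <->
    twisted_parallel.
  exact: (twisted_condE F (VF M) (fun X Y => g X Y) J gDl gC graph_JJ A h hDl h12 h23).
rewrite -{}E.
(* The deviation of the bracket from the graph [C] is tensorial. *)
have tw X Y Z :
    (courant (gr X) (gr Y) - courant (gr (J X)) (gr (J Y))).2 Z =
    (b (lie X Y - lie (J X) (J Y)) + g (lie X Y - lie (J X) (J Y))) Z +
    (h X Y Z - h (J X) (J Y) Z + g (A Z Y) (J X) *+ 2).
  transitivity ((courant (gr X) (gr Y)).2 Z - (courant (gr (J X)) (gr (J Y))).2 Z) => //.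
  rewrite !courant_graph.
  apply: (eq_lincomb2 (S X Y Z) (esym (S (J X) (J Y) Z))).
  by rewrite -T /act (raddfB b) (raddfB g) !(Form1_addE, Form1_oppE); ring.
have Ctw X Y : C (courant (gr X) (gr Y) - courant (gr (J X)) (gr (J Y))) <->
    (forall Z, h X Y Z - h (J X) (J Y) Z + g (A Z Y) (J X) *+ 2 = 0).
  split=> [/CE Cw Z|H].
    by apply: (@addrI _ ((b (lie X Y - lie (J X) (J Y)) + g (lie X Y - lie (J X) (J Y))) Z));
      rewrite addr0 -tw Cw.
  by apply/CE; apply: Form1_ext => Z; rewrite tw H addr0.
have Cext u v : C u -> C v -> u.1 = v.1 -> u = v.
  by move=> /CE Cu /CE Cv E; apply: TT_ext => // Z; rewrite Cu Cv E.
have grC u : C u -> u = gr u.1.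
  by move=> Cu; apply: Cext (Cgr _) _.
(* The argument of [J1] is rewritten as the same combination for the pair X, JY, so that [Ctw]
   applies to both summands. *)
have NE X Y : nijenhuis (@courant R m M) J1 (gr X) (gr Y) =
    (courant (gr X) (gr Y) - courant (gr (J X)) (gr (J Y))) +
    J1 (courant (gr X) (gr (J Y)) - courant (gr (J X)) (gr (J (J Y)))).
  have -> : gr (J (J Y)) = - gr Y.
    by rewrite graph_JJ (raddfN b) (raddfN g) -opprD.
  by rewrite courantNr opprK -!J1gr.
have NE1 X Y : C (courant (gr X) (gr (J Y)) - courant (gr (J X)) (gr (J (J Y)))) ->
    (nijenhuis (@courant R m M) J1 (gr X) (gr Y)).1 = nijenhuis (@lie R m M) J X Y.
  move=> /JE E; rewrite NE TT_add1 -E.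
  have -> : (courant (gr X) (gr (J Y)) - courant (gr (J X)) (gr (J (J Y)))).1 =
    lie X (J Y) - lie (J X) (J (J Y)) by [].
  by rewrite graph_JJ [lie (J X) (- Y)](additive_opp (lie (J X)) (lieDr _ _ M (J X))) opprK.
rewrite (closed_eigen J1 (courantDl _ _ M) (courantDr _ _ M) J1J1 CJ1 CN).
split=> [H|[N0 B] u v].
  have HC X Y : C (courant (gr X) (gr Y) - courant (gr (J X)) (gr (J Y))).
    by have [_] := H _ _ (Cgr X) (Cgr Y); rewrite -!J1gr.
  split=> [X Y|X Y]; last exact/Ctw.
  by rewrite -NE1 //; have [-> _] := H _ _ (Cgr X) (Cgr Y).
have HC X Y : C (courant (gr X) (gr Y) - courant (gr (J X)) (gr (J Y))).
  exact/Ctw/B.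
move=> /grC -> /grC ->; split; last by have := HC u.1 v.1; rewrite -!J1gr.
rewrite NE; apply/eqP; rewrite addr_eq0; apply/eqP/Cext => //; first exact/CN/CJ1/HC.
apply/eqP; rewrite -addr_eq0; apply/eqP.
by rewrite -(N0 u.1 v.1) -NE1 // NE.
Qed.

Lemma graph_nijenhuis_type : twisted_parallel ->
  (forall X Y, nijenhuis (@lie R m M) J X Y = 0) <->
  (forall X Y Z, h X Y Z = h (J X) (J Y) Z + h (J X) Y (J Z) + h X (J Y) (J Z)).
Proof.
exact: (nijenhuis_type F _ (VF M) (halfFK _ _ M) nabla (fun X Y => g X Y) J gDl gC
  g_inj graph_JJ graph_gJ (@lie R m M) A nabla_lie AE h hDl h12 h23).
Qed.

Lemma graph_parallel (K : VF M -> VF M -> VF M) :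
  (forall X Y Z, g (K X Y) Z *+ 2 = h X Y Z) ->
  parallel (fun X Y => nabla X Y + K X Y) J <-> twisted_parallel.
Proof.
exact: (parallelE F _ (VF M) (halfFK _ _ M) nabla (fun X Y => g X Y) J gDl gC
  g_inj graph_JJ graph_gJ A AE h K).
Qed.

Lemma graph_d_omega : (forall X Y, nijenhuis (@lie R m M) J X Y = 0) ->
  twisted_parallel <->
  (forall X Y Z, d2 (omega g J) (J X) Y Z + d2 (omega g J) X (J Y) Z
     + d2 (omega g J) X Y (J Z) + d2 (omega g J) (J X) (J Y) (J Z) *+ 3 = h X Y Z *+ 4).
Proof.
exact: (twisted_d_omega F _ (VF M) (halfFK _ _ M) act nabla (fun X Y => g X Y) J
  actD nablaDl nablaDr gDl gC g_inj nabla_g graph_JJ graph_gJ (@lie R m M) A nabla_lie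
  AE (d2 (omega g J))
  (fun _ _ _ => erefl) h hDl h12 h23).
Qed.

Let NE : cx_integrable J <-> forall X Y, nijenhuis (@lie R m M) J X Y = 0.
Proof. exact: (closed_eigenT J (lieDl _ _ M) (lieDr _ _ M) graph_JJ). Qed.

Lemma graph_courant_integrable :
  closed_under (cbil (@courant R m M)) (eigen_i J1 `&` csub C) <->
  cx_integrable J /\ twisted_parallel.
Proof. by rewrite NE; exact: graph_closed. Qed.

Lemma graph_type : twisted_parallel -> cx_integrable J <-> type_21_12 J h.
Proof.
move=> B; rewrite NE (type_21_12E _ _ _ J h hDl h12 h23).
exact: graph_nijenhuis_type.
Qed.

Lemma graph_omegaD X X' Y : omega g J (X + X') Y = omega g J X Y + omega g J X' Y.
Proof. by rewrite /omega raddfD gDl. Qed.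
Lemma graph_omegaC X Y : omega g J Y X = - omega g J X Y.
Proof.
rewrite /omega (gC (J X) Y) -(graph_gJ Y (J X)) graph_JJ Form1_N.
by rewrite opprK.
Qed.
Lemma graph_omegaJ X Y : omega g J (J X) (J Y) = omega g J X Y.
Proof. by rewrite /omega graph_gJ. Qed.

Lemma graph_dc : cx_integrable J -> twisted_parallel <->
  (forall X Y Z : cplx (VF M), - dc J (cbil (omega g J)) X Y Z = ctri h X Y Z).
Proof.
move=> /NE N0; rewrite (graph_d_omega N0).
by rewrite (dc_eq_opp_ctri _ _ _ J graph_JJ (omega g J) graph_omegaD graph_omegaC
  graph_omegaJ h hDl h12 h23).
Qed.

End GraphBundle.

(** * Nondegeneracy of the metric *)

Section AssociatedData.
Variables (R : realType) (m : nat) (M : manifold R m).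
Local Notation F := (Cinf M).
Implicit Types (X Y Z : VF M).

Lemma riemannian_inj (g : {linear VF M -> Form1 M}) : riemannian g ->
  forall X, (forall Y, g X Y = 0) -> X = 0.
Proof.
move=> [_ gpos] X gX; apply: VF_ext => f; apply/val_inj/funext => p.
apply/eqP/negPn/negP => Xfp.
by have := gpos X p (ex_intro _ f Xfp); rewrite gX ltxx.
Qed.

(* Hence [sharp] is applied to a genuine 1-form and its default value is not used. *)
Lemma d2_form (b : {linear VF M -> Form1 M}) : is_2form b ->
  forall X Y, exists xi : Form1 M, forall Z, xi Z = d2 (fun X Y => b X Y) X Y Z.
Proof.
move=> b0 X Y; have bC := is_2form_skew _ _ _ b b0.
exists (lieD1 X (b Y) - lieD1 Y (b X) + d0 (b X Y) - b (lie X Y)) => Z.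
transitivity (X (b Y Z) - b Y (lie X Z) - (Y (b X Z) - b X (lie Y Z))
  + Z (b X Y) - b (lie X Y) Z : F) => //.
rewrite /d2 /ext_d2 (bC Y (lie X Z)) (bC X (lie Y Z)).
by ring.
Qed.

Variables (J1 J2 : {linear TT M -> TT M}).
Variables (g b : {linear VF M -> Form1 M}) (Jp Jm : {linear VF M -> VF M}).
Hypothesis hJ : almost_gen_kahler J1 J2.
Hypothesis hdata : associated_data J1 J2 g b Jp Jm.

(** Split (0, xi) along C+ and C-: the two vector parts are opposite, so the terms in b cancel and
    those in g add up. *)
Lemma metric_surj (xi : Form1 M) : exists X, g X = xi.
Proof.
have [v /(ad_Cplus hdata) Cv [w /(ad_Cminus hdata) Cw E]] :=
  Cplus_Cminus_decomp _ _ _ J1 J2 hJ (0, xi).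
have E1 : v.1 = - w.1 by apply/eqP; rewrite -addr_eq0 -TT_add1 -E.
exists (v.1 - w.1).
have -> : xi = v.2 + w.2 by rewrite -TT_add2 -E.
rewrite Cv Cw E1 (raddfB g) (raddfN b) !(raddfN g).
by rewrite addrACA addNr add0r.
Qed.

Lemma sharpP X Y Z :
  g (sharp g (d2 (fun X Y => b X Y) X Y)) Z = d2 (fun X Y => b X Y) X Y Z.
Proof.
have [xi xiE] := d2_form b (ad_2form hdata) X Y; have [U gU] := metric_surj xi.
by apply: (@xgetPex _ 0 [set U | forall W, g U W = d2 (fun X Y => b X Y) X Y W]);
  exists U => W; rewrite gU xiE.
Qed.

End AssociatedData.

Lemma levi_civitaN (R : realType) (m : nat) (M : manifold R m)
    (g : {linear VF M -> Form1 M}) nabla :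
  levi_civita g nabla -> levi_civita (\- g) nabla.
Proof.
move=> [l1 l2 l3 l4 l5]; split=> // X Y Z.
transitivity (X (- g Y Z : Cinf M)) => //.
by rewrite VF_N l5 opprD.
Qed.

(** * Assembly of the equivalences *)

Theorem theorem6p28 (R : realType) (n : nat) (M : manifold R (2 * n)%N)
    (J1 J2 : {linear TT M -> TT M})
    (g b : {linear VF M -> Form1 M}) (Jp Jm : {linear VF M -> VF M})
    (nabla : VF M -> VF M -> VF M)
    (hJ : almost_gen_kahler J1 J2)
    (hdata : associated_data J1 J2 g b Jp Jm)
    (hnabla : levi_civita g nabla) :
  let h := d2 (fun X Y => b X Y) in
  [/\ gen_kahler_integrable J1 J2 <->
        (courant_integrable (L1plus J1 J2) /\ courant_integrable (L1minus J1 J2)),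
      gen_kahler_integrable J1 J2 <->
        [/\ cx_integrable Jp,
            cx_integrable Jm,
            forall X Y Z, dc Jm (cbil (omega g Jm)) X Y Z = ctri h X Y Z &
            forall X Y Z, - dc Jp (cbil (omega g Jp)) X Y Z = ctri h X Y Z],
      gen_kahler_integrable J1 J2 <->
        [/\ parallel (nabla_plus g nabla h) Jp,
            parallel (nabla_minus g nabla h) Jm,
            type_21_12 Jp h &
            type_21_12 Jm h] &
      parallel (nabla_plus g nabla h) Jp -> parallel (nabla_minus g nabla h) Jm ->
        cx_integrable Jp -> cx_integrable Jm ->
        type_21_12 Jp h /\ type_21_12 Jm h].
Proof.
move=> h.
(* C- is the graph of b + g', and g' has the same Levi-Civita connection as g, so the results on
   graphs serve both signs. *)
pose g' : {linear VF M -> Form1 M} := \- g.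
have [[J1orth J1J1] _ _ _] := hJ.
have [gmet b0 Cp Cm JpE JmE] := hdata.
have gC : forall X Y, g X Y = g Y X by case: gmet.
have g'C X Y : g' X Y = g' Y X.
  by transitivity (- g X Y : Cinf M); rewrite // gC.
have g_inj := riemannian_inj _ _ _ g gmet.
have g'_inj X : (forall Y, g' X Y = 0) -> X = 0.
  by move=> H; apply: g_inj => Y; apply/eqP; rewrite -oppr_eq0; apply/eqP/H.
have hnabla' : levi_civita g' nabla := levi_civitaN _ _ _ g nabla hnabla.
have CJp := Cplus_J1 _ _ _ J1 J2 hJ.
have CJm := Cminus_J1 _ _ _ J1 J2 hJ.
have shE X Y Z : g (sharp g (h X Y)) Z = h X Y Z := sharpP _ _ _ J1 J2 g b Jp Jm hJ hdata X Y Z.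
pose K X Y := halfF M *: sharp g (h X Y).
have gK X Y Z : g (K X Y) Z *+ 2 = h X Y Z.
  rewrite /K linearZ Form1_scaleE shE.
  by rewrite -[RHS]mul1r -(halfFK _ _ M); ring.
(* Here (1/2) g'^{-1} h is -K, so the connection attached to g' is [nabla_minus]. *)
have g'K X Y Z : g' (- K X Y) Z *+ 2 = h X Y Z.
  rewrite -gK; congr (_ *+ 2).
  transitivity (- g (- K X Y) Z : Cinf M) => //.
  by rewrite (raddfN g) Form1_oppE opprK.
have closedp := graph_courant_integrable _ _ _ J1 _ b g Jp nabla J1J1 Cp CJp JpE b0 gC
  J1orth hnabla.
have closedm := graph_courant_integrable _ _ _ J1 _ b g' Jm nabla J1J1 Cm CJm JmE b0 g'C
  J1orth hnabla'.
have typep := graph_type _ _ _ J1 _ b g Jp nabla J1J1 Cp CJp JpE b0 gC g_inj J1orth hnabla.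
have typem := graph_type _ _ _ J1 _ b g' Jm nabla J1J1 Cm CJm JmE b0 g'C g'_inj J1orth hnabla'.
have dcp := graph_dc _ _ _ J1 _ b g Jp nabla J1J1 Cp CJp JpE b0 gC g_inj J1orth hnabla.
have dcm := graph_dc _ _ _ J1 _ b g' Jm nabla J1J1 Cm CJm JmE b0 g'C g'_inj J1orth hnabla'.
have parp : parallel (nabla_plus g nabla h) Jp <-> twisted_parallel _ _ M b g Jp nabla :=
  graph_parallel _ _ _ J1 _ b g Jp nabla J1J1 Cp CJp JpE b0 gC g_inj J1orth K gK.
have parm : parallel (nabla_minus g nabla h) Jm <-> twisted_parallel _ _ M b g' Jm nabla :=
  graph_parallel _ _ _ J1 _ b g' Jm nabla J1J1 Cm CJm JmE b0 g'C g'_inj J1orth _ g'K.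
(* From here (ii) replaces [twisted_parallel] by the d^c equations, given integrable J+ and J-,
   while (iii) replaces integrability by the type of h, given [twisted_parallel]. *)
have integrableE : gen_kahler_integrable J1 J2 <->
    (cx_integrable Jp /\ twisted_parallel _ _ M b g Jp nabla) /\
    (cx_integrable Jm /\ twisted_parallel _ _ M b g' Jm nabla).
  by rewrite (gen_kahler_integrableE _ _ _ J1 J2 hJ) -closedp -closedm.
(* Returning from g' to g reverses the sign of omega_-, hence the opposite signs in d^c_- omega_- =
   - d^c_+ omega_+ = h. *)
have dcm' X Y Z : dc Jm (cbil (omega g Jm)) X Y Z = - dc Jm (cbil (omega g' Jm)) X Y Z.
  have -> : omega g Jm = (fun X Y => - omega g' Jm X Y).
    apply/funext => X'; apply/funext => Y'.
    by transitivity (- - omega g Jm X' Y' : Cinf M); rewrite ?opprK.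
  apply: dcN.
  - exact: (graph_JJ _ _ _ J1 _ b g' Jm J1J1 Cm CJm JmE).
  - move=> X1 X2 Y1; exact: graph_omegaD.
  - exact: (graph_omegaC _ _ _ J1 _ b g' Jm J1J1 Cm CJm JmE b0 g'C J1orth).
  - exact: (graph_omegaJ _ _ _ J1 _ b g' Jm Cm CJm JmE b0 g'C J1orth).
split; first exact: gen_kahler_integrableE.
- split=> [/integrableE [[Np Bp] [Nm Bm]]|[Np Nm Dm Dp]].
    by split=> // [X Y Z|]; [rewrite dcm'; exact: (dcm Nm).1 | exact: (dcp Np).1].
  apply/integrableE; split; split=> //; first exact/(dcp Np).
  by apply/(dcm Nm) => X Y Z; rewrite -dcm'; exact: Dm.
- split=> [/integrableE [[Np Bp] [Nm Bm]]|[/parp Bp /parm Bm Tp Tm]].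
    by split; [exact/parp | exact/parm | exact/typep | exact/typem].
  by apply/integrableE; split; split=> //; [exact/typep | exact/typem].
- by move=> /parp Bp /parm Bm Np Nm; split; [exact/typep | exact/typem].
Qed.
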